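(* (Translation formula) Let $\psi$ be a Dirichlet character with $\psi(-1)=-1$, and let $r=\frac ac$ be a rational number with $c\geq 1$ and $\gcd(a,c)=1$. Define $\mathrm E_r^\psi(\tau)=\mathrm E_3^{\bm 1_1,\psi,1}(\tau+r)$. Then $$\mathrm E_r^\psi=\sum_{c=c_1c_2c_3}\ \sum_{\chi\in\widehat{(\mathbb Z/c_3\mathbb Z)^\times}}\frac{\chi(a)\,\mathfrak g(\bar\chi)\,\psi(c_1)\,c_1^2}{\varphi(c_3)}\cdot\mathrm E_3^{\chi,\ \bm 1_{c_2c_3}\chi\psi,\ c_1c_2},$$ where the outer sum is over ordered triples of positive integers with product $c$, $\mathfrak g(-)$ denotes the Gauss sum of a Dirichlet character and $\varphi$ is Euler's totient function.
   Context: $\bm 1_N$ is the trivial Dirichlet character modulo $N$; $\widehat{(\mathbb Z/N\mathbb Z)^\times}$ is the group of Dirichlet characters modulo $N$ (not necessarily primitive); $\mathfrak g(\chi)=\sum_{n\bmod N}\chi(n)e^{2\pi\mathtt in/N}$ for $\chi$ modulo $N$. For an integer $k\ge3$, Dirichlet characters $\chi$ (modulo $N_\chi$) and $\psi$ with $\chi\psi(-1)=(-1)^k$ and $n\ge1$, the normalized Eisenstein series is, with $q=e^{2\pi\mathtt i\tau}$, $\tau\in\mathbb H$, $$\mathrm E_k^{\chi,\psi,n}(\tau)=\tfrac12\delta_{\bm 1_1,\chi}\,\mathrm L(1-k,\psi)+\sum_{m\ge1}\psi(m)m^{k-1}\sum_{\nu=1}^{N_\chi}\frac{\chi(\nu)q^{\nu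 mn}}{1-q^{N_\chi mn}},$$ where $\delta_{\bm 1_1,\chi}$ is $1$ if $\chi=\bm 1_1$ and $0$ otherwise, and $\mathrm L(s,\psi)$ is the Dirichlet $\mathrm L$-function. *)

(* Defs.v *)
From HB Require Import structures.
From mathcomp Require Import all_boot all_order all_algebra.
From mathcomp Require Import complex.
From mathcomp Require Import all_classical all_reals all_analysis.
Import Order.TTheory GRing.Theory Num.Theory.
Import numFieldNormedType.Exports.

Set Implicit Arguments.
Unset Strict Implicit.
Unset Printing Implicit Defensive.

Local Open Scope classical_set_scope.
Local Open Scope complex_scope.
Local Open Scope ring_scope.

(* Neither real-closed nor MathComp-Analysis gives [R[i]] the topology of its
   modulus; this is the one every [numFieldType] carries. *)
HB.instance Definition _ (R : rcfType) :=
  NormedModule.copy R[i] ((R[i] : numFieldType)^o).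

Definition cexp (R : realType) (z : R[i]) : R[i] :=
  (expR (complex.Re z))%:C * (cos (complex.Im z) +i* sin (complex.Im z)).

Definition two_pi_i (R : realType) : R[i] := 0 +i* (2 * pi).

(* A Dirichlet character modulo N (N >= 1), not necessarily primitive, as a
   function on the integers. *)
Record dirichlet_char (R : realType) (N : nat) (chi : int -> R[i]) : Prop :=
  DirichletChar {
    dchar_one : chi 1 = 1;
    dchar_mul : forall m n, chi (m * n) = chi m * chi n;
    dchar_per : forall m, chi (m + N%:Z) = chi m;
    dchar_eq0 : forall m, (chi m == 0) = ~~ coprimez m N%:Z }.

Definition dirichlet_group (R : realType) (N : nat) : set (int -> R[i]) :=
  [set chi | dirichlet_char N chi].
Arguments dirichlet_group : clear implicits.

Definition triv_char (R : realType) (N : nat) : int -> R[i] :=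
  fun m => (coprimez m N%:Z)%:R.
Arguments triv_char : clear implicits.

Definition conj_char (R : realType) (chi : int -> R[i]) : int -> R[i] :=
  fun m => (chi m)^*.

Definition gauss_sum (R : realType) (N : nat) (chi : int -> R[i]) : R[i] :=
  \sum_(0 <= n < N) chi n%:Z * cexp (two_pi_i R * n%:R / N%:R).

Definition analytic_at (R : realType) (f : R[i] -> R[i]) (s0 : R[i]) : Prop :=
  exists (a : nat -> R[i]) (e : R), 0 < e /\
    forall s, `|s - s0| < e%:C ->
      series (fun n => a n * (s - s0) ^+ n) @ \oo --> f s.

(* [F] is the analytic continuation to C \ {1} of the Dirichlet series
   sum_(m >= 1) psi(m) m^(-s), Re s > 1. *)
Definition is_dirichlet_L (R : realType) (psi : int -> R[i])
    (F : R[i] -> R[i]) : Prop :=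
  (forall s, 1 < complex.Re s ->
     series (fun m => psi m.+1%:Z * cexp (- s * (ln (m.+1%:R : R))%:C))
       @ \oo --> F s) /\
  (forall s, s != 1 -> analytic_at F s).

(* The conditions determine the value at every s != 1; the value at s = 1 is
   left unspecified. *)
Definition dirichlet_L (R : realType) (psi : int -> R[i]) : R[i] -> R[i] :=
  xget (fun=> 0) [set F | is_dirichlet_L psi F].

(* [Nchi] is the modulus of [chi]; the modulus of [psi] plays no role in the
   formula.  A character is constantly 1 on the integers only when its modulus
   is 1, so the test below is the delta of chi and the character modulo 1. *)
Definition eisenstein (R : realType) (k Nchi : nat) (chi psi : int -> R[i])
    (n : nat) (tau : R[i]) : R[i] :=
  let q := cexp (two_pi_i R * tau) in
  2^-1 * (chi == triv_char R 1)%:R * dirichlet_L psi (1 - k%:R) +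
  limn (series (fun j : nat => let m := j.+1 in
    psi m%:Z * m%:R ^+ k.-1 *
    \sum_(1 <= nu < Nchi.+1)
      chi nu%:Z * q ^+ (nu * m * n) / (1 - q ^+ (Nchi * m * n)))).

Definition eisenstein_shift (R : realType) (psi : int -> R[i]) (r : rat)
    (tau : R[i]) : R[i] :=
  eisenstein 3 1 (triv_char R 1) psi 1 (tau + ratr r).

(* Main.v *)
Require Import Defs.
From mathcomp Require Import all_boot all_order all_algebra.
From mathcomp Require Import complex ring lra.
From mathcomp Require Import cyclic separable cyclotomic.
From mathcomp Require Import all_classical all_reals all_analysis.
Import Order.TTheory GRing.Theory Num.Theory.
Import numFieldNormedType.Exports.

Set Implicit Arguments.
Unset Strict Implicit.
Unset Printing Implicit Defensive.

Local Open Scope classical_set_scope.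
Local Open Scope complex_scope.
Local Open Scope ring_scope.

(* Put q = e(tau), zeta = e(a/c). The q-part of the left side is the sum over M of
   psi(M) M^2 y/(1 - y) with y = (zeta q)^M. Sort the M by c1 = gcd(M, c), so
   M = c1 m with m prime to e = c/c1, and expand y/(1 - y) as the sum of
   y^V/(1 - y^e) over 1 <= V <= e; since e(a m/e)^e = 1, the denominator is
   1 - q^(M e). Sorting the V by c2 = gcd(V, e), V = c2 nu and c3 = e/c2, the
   coefficient of q^(M V) is e(a m nu/c3) with a m nu prime to c3, and orthogonality
   of the characters modulo c3 writes it as
   1/phi(c3) times the sum over chi of chi(a m nu) g(conj chi).

   The constant terms reduce to
   sum_(c1 c2 = c) psi(c1) c1^2 L(-2, 1_(c2) psi) = L(-2, psi).
   Sorting by gcd(m, c) proves sum_(c1 c2 = c) psi(c1) c1^(-s) L(s, 1_(c2) psi) =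
   L(s, psi) for Re s > 1, and the identity theorem carries it to s = -2. The
   continuations exist because psi is odd: the periodic coefficients have mean
   zero, so they are differences of periodic coefficients of mean zero, and
   summing by parts K times leaves the K-th differences of x^(-s), which are
   O(x^(-Re s - K)).

   Completeness of the character group modulo c comes from simultaneously
   diagonalizing the regular representation of (Z/c)^x. *)

(** * Convergence of complex sequences and power series *)

Section ComplexNorm.
Variable R : realType.
Implicit Types (z w : R[i]) (x : R).

(** The norm of [R[i]] takes its values in [R[i]]. A real-valued modulus makes the order and the
    limits of [R] available. *)
Definition cabs z : R := complex.Re `|z|.

Lemma cabsE z : `|z| = (cabs z)%:C.
Proof. by rewrite /cabs RRe_real// normr_real. Qed.

Lemma cabs_ge0 z : 0 <= cabs z.
Proof. by rewrite -ler0c -cabsE. Qed.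

Lemma cabsM z w : cabs (z * w) = cabs z * cabs w.
Proof. by apply: complexI; rewrite rmorphM -!cabsE normrM. Qed.

Lemma cabsD z w : cabs (z + w) <= cabs z + cabs w.
Proof. by rewrite -lecR rmorphD -!cabsE ler_normD. Qed.

Lemma cabsN z : cabs (- z) = cabs z.
Proof. by rewrite /cabs normrN. Qed.

Lemma cabsB z w : cabs (z - w) = cabs (w - z).
Proof. by rewrite -cabsN opprB. Qed.

Lemma cabs0 : cabs 0 = 0.
Proof. by rewrite /cabs normr0. Qed.

Lemma cabs1 : cabs 1 = 1.
Proof. by rewrite /cabs normr1. Qed.

Lemma cabsX z n : cabs (z ^+ n) = cabs z ^+ n.
Proof. by apply: complexI; rewrite rmorphXn -!cabsE normrX. Qed.

Lemma cabsV z : cabs z^-1 = (cabs z)^-1.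
Proof. by apply: complexI; rewrite fmorphV -!cabsE normfV. Qed.

Lemma cabsC x : cabs x%:C = `|x|.
Proof.
by rewrite /cabs normc_def /= expr0n addr0 sqrtr_sqr.
Qed.

Lemma cabs_nat n : cabs n%:R = n%:R.
Proof. by rewrite /cabs normr_nat -(rmorph_nat (real_complex R)). Qed.

Lemma cabs_gt0 z : (0 < cabs z) = (z != 0).
Proof. by rewrite -ltcR -cabsE normr_gt0. Qed.

Lemma cabs_eq0 z : (cabs z == 0) = (z == 0).
Proof. by rewrite -(inj_eq (@complexI _)) -cabsE normr_eq0. Qed.

Lemma cabs_sum (I : Type) (r : seq I) (P : pred I) (F : I -> R[i]) :
  cabs (\sum_(i <- r | P i) F i) <= \sum_(i <- r | P i) cabs (F i).
Proof.
by rewrite -lecR rmorph_sum -cabsE (le_trans (ler_norm_sum _ _ _))//.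
Qed.

Lemma Re_le_cabs z : `|complex.Re z| <= cabs z.
Proof. by rewrite -lecR -cabsE normc_ge_Re. Qed.

Lemma Im_le_cabs z : `|complex.Im z| <= cabs z.
Proof.
have := Re_le_cabs (z * 'i%C); rewrite ReiNIm normrN cabsM.
by rewrite {2}/cabs normc_def /= expr0n expr1n add0r sqrtr1 mulr1.
Qed.

Lemma cabs_le_ReIm z : cabs z <= `|complex.Re z| + `|complex.Im z|.
Proof.
case: z => a b /=; rewrite [_ +i* _]complexE /= (le_trans (cabsD _ _))//.
by rewrite cabsM !cabsC {1}/cabs normc_def /= expr0n expr1n add0r sqrtr1 mul1r.
Qed.

Definition ccvg (u : nat -> R[i]) (l : R[i]) : Prop :=
  forall e : R, 0 < e -> \forall n \near \oo, cabs (u n - l) < e.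

Lemma ccvgP (u : nat -> R[i]) (l : R[i]) : u @ \oo --> l <-> ccvg u l.
Proof.
split=> [/cvgrPdist_lt ul e e0|ul].
  have e0' : 0 < e%:C by rewrite ltcR.
  by apply: filterS (ul _ e0') => n /=; rewrite distrC cabsE ltcR.
apply/cvgrPdist_lt => e /[dup] e0; rewrite ltcE => /andP[/eqP eI eR].
(* A positive element of [R[i]] has imaginary part 0, so the tolerance is a real number. *)
have -> : e = (complex.Re e)%:C by rewrite RRe_real// gtr0_real.
by apply: filterS (ul _ eR) => n /=; rewrite distrC cabsE ltcR.
Qed.

Lemma ccvg_cabs0 (u : nat -> R[i]) (l : R[i]) :
  ccvg u l <-> (fun n => cabs (u n - l)) @ \oo --> (0 : R).
Proof.
split=> [ul|/cvgrPdist_lt ul e /ul].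
  apply/cvgrPdist_lt => e /ul; apply: filterS => n.
  by rewrite sub0r normrN ger0_norm// cabs_ge0.
by apply: filterS => n; rewrite sub0r normrN ger0_norm// cabs_ge0.
Qed.

Lemma ccvg_squeeze (u : nat -> R[i]) (l : R[i]) (v : nat -> R) :
  (forall n, cabs (u n - l) <= v n) -> v @ \oo --> (0 : R) -> ccvg u l.
Proof.
move=> uv v0; apply/ccvg_cabs0; apply: (@squeeze_cvgr _ _ _ _ (fun=> 0) v) => //.
- by apply: nearW => n; rewrite cabs_ge0 uv.
- exact: cvg_cst.
Qed.

Lemma ccvg_cst (l : R[i]) : ccvg (fun=> l) l.
Proof. by move=> e e0; apply: nearW => n; rewrite subrr cabs0. Qed.

Lemma ccvgD (u w : nat -> R[i]) (l m : R[i]) : ccvg u l -> ccvg w m ->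
  ccvg (fun n => u n + w n) (l + m).
Proof.
move=> ul wm e e0; have e2 : 0 < e / 2 by rewrite divr_gt0.
apply: filterS2 (ul _ e2) (wm _ e2) => n h1 h2.
by rewrite opprD addrACA (le_lt_trans (cabsD _ _))// [e]splitr ltrD.
Qed.

Lemma ccvgN (u : nat -> R[i]) (l : R[i]) : ccvg u l -> ccvg (fun n => - u n) (- l).
Proof.
by move=> ul e /ul; apply: filterS => n; rewrite -opprD cabsN.
Qed.

Lemma ccvgB (u w : nat -> R[i]) (l m : R[i]) : ccvg u l -> ccvg w m ->
  ccvg (fun n => u n - w n) (l - m).
Proof. by move=> ul wm; exact: ccvgD ul (ccvgN wm). Qed.

Lemma ccvgMl (u : nat -> R[i]) (l c : R[i]) : ccvg u l ->
  ccvg (fun n => c * u n) (c * l).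
Proof.
move=> /ccvg_cabs0 ul; apply: (@ccvg_squeeze _ _ (fun n => cabs c * cabs (u n - l))).
  by move=> n; rewrite -mulrBr cabsM.
by rewrite -(mulr0 (cabs c)); apply: cvgMl_tmp.
Qed.

Lemma ccvg_comp (u : nat -> R[i]) (l : R[i]) (f : nat -> nat) :
  ccvg u l -> f @ \oo --> \oo -> ccvg (u \o f) l.
Proof. by move=> ul fo e /ul; exact: fo. Qed.

Lemma ccvg_shift (u : nat -> R[i]) (l : R[i]) J :
  ccvg (fun n => u (n + J)%N) l <-> ccvg u l.
Proof.
split=> ul e /ul [N _ HN]; last first.
  by exists N => // n Nn /=; apply: HN; rewrite /= (leq_trans Nn)// leq_addr.
exists (N + J)%N => // n /= Nn.
have Jn : (J <= n)%N := leq_trans (leq_addl _ _) Nn.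
by have := HN (n - J)%N; rewrite /= subnK//; apply; rewrite leq_subRL// addnC.
Qed.

Lemma ccvg_unique (u : nat -> R[i]) (l l' : R[i]) : ccvg u l -> ccvg u l' -> l = l'.
Proof.
move=> ul ul'; apply/eqP; rewrite -subr_eq0 -cabs_eq0.
apply/eqP/le_anti/andP; split; last exact: cabs_ge0.
apply/ler_addgt0Pr => e e0; rewrite add0r.
have e2 : 0 < e / 2 by rewrite divr_gt0.
near \oo => n.
have -> : l - l' = (u n - l') - (u n - l) by rewrite opprB [RHS]addrC addrA subrK.
rewrite (le_trans (cabsD _ _))// cabsN [e]splitr lerD//.
- by apply/ltW; near: n; exact: ul'.
- by apply/ltW; near: n; exact: ul.
Unshelve. all: by end_near. Qed.

Lemma climE (u : nat -> R[i]) (l : R[i]) : ccvg u l -> limn u = l.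
Proof.
move=> ul; apply: (@ccvg_unique u) => //; apply/ccvgP.
have /ccvgP ul' := ul.
by apply/cvg_ex; exists l.
Qed.

Lemma ccvg_ReIm (u : nat -> R[i]) (a b : R) :
  (fun n => complex.Re (u n)) @ \oo --> a ->
  (fun n => complex.Im (u n)) @ \oo --> b -> ccvg u (a +i* b).
Proof.
move=> ua ub; apply: (@ccvg_squeeze _ _
  (fun n => `|complex.Re (u n) - a| + `|complex.Im (u n) - b|)).
  by move=> n; rewrite (le_trans (cabs_le_ReIm _))//; case: (u n).
have -> : (0 : R) = `|a - a| + `|b - b| by rewrite !subrr normr0 addr0.
by apply: cvgD; apply: cvg_norm; apply: cvgB => //; exact: cvg_cst.
Qed.

Lemma ccvg_cabs_le (u : nat -> R[i]) (l : R[i]) (M : R) :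
  ccvg u l -> (forall n, cabs (u n) <= M) -> cabs l <= M.
Proof.
move=> ul uM; apply/ler_addgt0Pr => e e0.
near \oo => n.
have -> : l = u n - (u n - l) by rewrite opprB addrC subrK.
rewrite (le_trans (cabsD _ _))// cabsN lerD//.
by apply/ltW; near: n; exact: ul.
Unshelve. all: by end_near. Qed.

End ComplexNorm.

(** * Sums of complex series: domination, interchange of summations, Cauchy products *)

Section ComplexSeries.
Variable R : realType.
Implicit Types (u : nat -> R[i]) (v : nat -> R).

Lemma sum_Re I (r : seq I) (F : I -> R[i]) :
  complex.Re (\sum_(i <- r) F i) = \sum_(i <- r) complex.Re (F i).
Proof. by elim/big_rec2: _ => //= i x y _ <-; case: (F i) y => ? ? []. Qed.

Lemma sum_Im I (r : seq I) (F : I -> R[i]) :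
  complex.Im (\sum_(i <- r) F i) = \sum_(i <- r) complex.Im (F i).
Proof. by elim/big_rec2: _ => //= i x y _ <-; case: (F i) y => ? ? []. Qed.

Definition csum u (l : R[i]) : Prop := ccvg (series u) l.

(** Real and imaginary parts are bounded by the modulus, so both real series converge absolutely. *)
Lemma csum_dominated u v :
  (forall n, cabs (u n) <= v n) -> cvgn (series v) -> exists l, csum u l.
Proof.
move=> uv cv.
have aux (w : nat -> R) : (forall n, `|w n| <= cabs (u n)) -> cvgn (series w).
  move=> wu; apply: normed_cvg; apply: (series_le_cvg _ _ _ cv) => n /=.
  - exact: normr_ge0.
  - exact: le_trans (cabs_ge0 _) (uv n).
  - exact: le_trans (wu n) (uv n).
have /cvg_ex[a ha] := aux (fun n => complex.Re (u n)) (fun n => Re_le_cabs _).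
have /cvg_ex[b hb] := aux (fun n => complex.Im (u n)) (fun n => Im_le_cabs _).
exists (a +i* b); apply: ccvg_ReIm.
- by under eq_fun do rewrite /series/= sum_Re.
- by under eq_fun do rewrite /series/= sum_Im.
Qed.

Lemma cabs_csum_le u v (l : R[i]) (s : R) :
  (forall n, cabs (u n) <= v n) -> csum u l ->
  series v @ \oo --> s -> cabs l <= s.
Proof.
move=> uv ul vs; apply: (ccvg_cabs_le ul) => n.
have v0 k : 0 <= v k by exact: le_trans (cabs_ge0 _) (uv k).
rewrite (le_trans (cabs_sum _ _ _))//.
apply: (@le_trans _ _ (series v n)); first exact: ler_sum.
rewrite -(cvg_lim _ vs)//; apply: nondecreasing_cvgn_le.
- by apply: nondecreasing_series => k _ _; exact: v0.
- by apply/cvg_ex; exists s.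
Qed.

Lemma series_tailE (V : zmodType) (w : nat -> V) J n :
  series (fun n => w (n + J)%N) n = series w (n + J)%N - series w J.
Proof.
rewrite series_addn addrC addKr /series/= -{2}[J]add0n big_addn addnK.
by [].
Qed.

Lemma cvg_series_tail v (l : R) J :
  series v @ \oo --> l ->
  series (fun n => v (n + J)%N) @ \oo --> l - series v J.
Proof.
move=> wl.
have -> : series (fun n => v (n + J)%N) = fun n => series v (n + J)%N - series v J.
  by apply/funext => n; rewrite series_tailE.
by apply: cvgB; [rewrite cvg_shiftn|exact: cvg_cst].
Qed.

Lemma csum_tail u (l : R[i]) J :
  csum u l -> csum (fun n => u (n + J)%N) (l - series u J).
Proof.
move=> ul; rewrite /csum.
have -> : series (fun n => u (n + J)%N) = fun n => series u (n + J)%N - series u J.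
  by apply/funext => n; rewrite series_tailE.
by apply: ccvgB; [exact/ccvg_shift|exact: ccvg_cst].
Qed.

Lemma cabs_csum_tail_le u v (l : R[i]) (s : R) J :
  (forall n, cabs (u n) <= v n) -> csum u l ->
  series v @ \oo --> s -> cabs (l - series u J) <= s - series v J.
Proof.
move=> uv ul vs.
have h1 := csum_tail J ul; have h2 := cvg_series_tail (J := J) vs.
refine (cabs_csum_le (fun n => uv (n + J)%N) h1 _).
exact: h2.
Qed.

Lemma csum_unique u (l l' : R[i]) : csum u l -> csum u l' -> l = l'.
Proof. exact: ccvg_unique. Qed.

Lemma eq_csum u u' (l : R[i]) : u =1 u' -> csum u l -> csum u' l.
Proof. by move=> /funext->. Qed.

Lemma csum_sum I (r : seq I) (P : pred I) (U : I -> nat -> R[i]) (L : I -> R[i]) :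
  (forall i, P i -> csum (U i) (L i)) ->
  csum (fun n => \sum_(i <- r | P i) U i n) (\sum_(i <- r | P i) L i).
Proof.
move=> UL.
have -> : csum (fun n => \sum_(i <- r | P i) U i n) =
          ccvg (fun n => \sum_(i <- r | P i) series (U i) n).
  by congr ccvg; apply/funext => n; rewrite /series/= exchange_big.
elim: r => [|i r IH].
  rewrite big_nil; under eq_fun do rewrite big_nil; exact: ccvg_cst.
rewrite big_cons; under eq_fun do rewrite big_cons.
by case: ifP => // Pi; apply: ccvgD => //; exact: UL.
Qed.

Lemma csumZ u (l c : R[i]) : csum u l -> csum (fun n => c * u n) (c * l).
Proof.
move=> ul.
have -> : csum (fun n => c * u n) = ccvg (fun n => c * series u n).
  by congr ccvg; apply/funext => n; rewrite /series/= mulr_sumr.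
exact: ccvgMl.
Qed.

Lemma csumD u u' (l l' : R[i]) : csum u l -> csum u' l' ->
  csum (fun n => u n + u' n) (l + l').
Proof.
move=> ul ul'.
have -> : csum (fun n => u n + u' n) = ccvg (fun n => series u n + series u' n).
  by congr ccvg; apply/funext => n; rewrite /series/= big_split.
exact: ccvgD.
Qed.

Lemma csumB u u' (l l' : R[i]) : csum u l -> csum u' l' ->
  csum (fun n => u n - u' n) (l - l').
Proof.
move=> ul /(csumZ (-1)) ul'.
rewrite -mulN1r; apply: eq_csum (csumD ul ul') => n.
by rewrite mulN1r.
Qed.

Lemma csum_cvg0 u (l : R[i]) : csum u l -> ccvg u 0.
Proof.
move=> ul; have := csum_tail 1 ul.
have -> : csum (fun n => u (n + 1)%N) (l - series u 1) =
          ccvg (fun n => series u n.+1 - series u 1) (l - series u 1).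
  by congr ccvg; apply/funext => n; rewrite series_tailE addn1.
move=> h; have := ccvgB (ccvgD h (ccvg_cst (series u 1))) ul.
rewrite subrK subrr; congr ccvg; apply/funext => n.
by rewrite subrK seriesSB.
Qed.

Lemma is_cvg_series_mull (c : R) v :
  cvgn (series v) -> cvgn (series (fun n => c * v n)).
Proof. by move=> cv; exact: (@is_cvg_seriesZ R v c cv). Qed.

Lemma geometric_domination (r M : R) (a : nat -> R[i]) (w : R[i]) :
  0 < r -> (forall k, cabs (a k) * r ^+ k <= M) -> cabs w < r ->
  (forall k, cabs (a k * w ^+ k) <= M * (cabs w / r) ^+ k) /\
  series (fun k => M * (cabs w / r) ^+ k) @ \oo --> M * (1 - cabs w / r)^-1.
Proof.
move=> r0 aM wr; split=> [k|].
  rewrite cabsM cabsX expr_div_n mulrA ler_pdivlMr ?exprn_gt0//.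
  by rewrite mulrAC ler_wpM2r// exprn_ge0// cabs_ge0.
apply: cvg_geometric_series; rewrite ger0_norm; first by rewrite ltr_pdivrMr// mul1r.
by rewrite divr_ge0 ?cabs_ge0// ltW.
Qed.

(** Interchange of summations. The J-th tail of each column, multiplied by [r ^+ k], is at most the
    tail [s - series M J] of the majorant. Summing over k against a geometric series of ratio |w|/r
    bounds [S - series g J] by a constant times that tail, which tends to 0. *)
Lemma double_csum (a : nat -> nat -> R[i]) (M : nat -> R) (r : R)
    (g : nat -> R[i]) (b : nat -> R[i]) (w : R[i]) :
  0 < r -> (forall j k, cabs (a j k) * r ^+ k <= M j) ->
  cvgn (series M) -> cabs w < r ->
  (forall j, csum (fun k => a j k * w ^+ k) (g j)) ->
  (forall k, csum (fun j => a j k) (b k)) ->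
  exists2 S, csum g S & csum (fun k => b k * w ^+ k) S.
Proof.
move=> r0 aM cM wr ag ab.
have /cvg_ex[/= s Ms] := cM.
have bbound J k : cabs (b k - series (fun j => a j k) J) * r ^+ k <= s - series M J.
  rewrite -ler_pdivlMr ?exprn_gt0//.
  have := @cabs_csum_tail_le (fun j => a j k) (fun j => M j / r ^+ k) (b k)
    (s / r ^+ k) J.
  have serE n : series (fun j => M j / r ^+ k) n = series M n / r ^+ k.
    by rewrite /series/= mulr_suml.
  rewrite mulrBl serE; apply=> //.
    by move=> j; rewrite ler_pdivlMr ?exprn_gt0.
  have -> : series (fun j => M j / r ^+ k) = fun n => series M n / r ^+ k.
    exact/funext.
  exact: cvgMr_tmp.
have b0 k : cabs (b k) * r ^+ k <= s.
  by have := bbound 0%N k; rewrite /series/= !big_geq// !subr0.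
have [dom1 dom2] := geometric_domination r0 b0 wr.
have [|S HS] := csum_dominated dom1.
  by apply/cvg_ex; eexists; exact: dom2.
exists S => //.
have key J : cabs (S - series g J) <= (s - series M J) * (1 - cabs w / r)^-1.
  have [d1 d2] := geometric_domination r0 (bbound J) wr.
  apply: (cabs_csum_le d1 _ d2).
  have h1 : csum (fun k => \sum_(0 <= j < J) a j k * w ^+ k) (series g J).
    by apply: csum_sum.
  apply: eq_csum (csumB HS h1) => k.
  by rewrite mulrBl mulr_suml.
apply: (@ccvg_squeeze _ _ _ (fun J => (s - series M J) * (1 - cabs w / r)^-1)).
  by move=> J; rewrite cabsB key.
rewrite -(mul0r (1 - cabs w / r)^-1); apply: cvgMr_tmp.
by rewrite -(subrr s); apply: cvgB => //; exact: cvg_cst.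
Qed.

Lemma csum_coef_bound (a : nat -> R[i]) (w l : R[i]) :
  csum (fun k => a k * w ^+ k) l ->
  exists2 M, 0 <= M & forall k, cabs (a k) * cabs w ^+ k <= M.
Proof.
move=> /csum_cvg0/ccvg_cabs0 cu.
have /cvg_has_ub[M HM] : cvgn (fun k => cabs (a k * w ^+ k - 0)).
  by apply/cvg_ex; exists 0.
exists `|M| => // k; rewrite -cabsX -cabsM (le_trans _ (ler_norm M))//.
by apply: HM; exists k => //; rewrite /= subr0 ger0_norm// cabs_ge0.
Qed.

Lemma series_delay (V : zmodType) (c : nat -> V) j n :
  series (fun k => if (j <= k)%N then c (k - j)%N else 0) (n + j)%N = series c n.
Proof.
rewrite series_addn [X in X + _]big_nat big1 ?add0r; last first.
  by move=> k /andP[_ kj]; rewrite leqNgt kj.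
rewrite -{1}[j]add0n big_addn addnK; apply: eq_bigr => k _.
by rewrite leq_addl addnK.
Qed.

Lemma csum_delay u (l : R[i]) j : csum u l ->
  csum (fun k => if (j <= k)%N then u (k - j)%N else 0) l.
Proof.
move=> ul; apply/(@ccvg_shift _ _ _ j).
have -> : (fun n => series (fun k => if (j <= k)%N then u (k - j)%N else 0) (n + j)%N)
  = series u by apply/funext => n; rewrite series_delay.
exact: ul.
Qed.

Lemma csum_finite u n : (forall k, (n <= k)%N -> u k = 0) -> csum u (series u n).
Proof.
move=> u0 e e0; near=> k.
rewrite (_ : series u k = series u n) ?subrr ?cabs0//.
have nk : (n <= k)%N by near: k; exact: nbhs_infty_ge.
rewrite -(subnK nk) series_addn [X in _ + X]big_nat big1 ?addr0// => i.
by move=> /andP[/u0].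
Unshelve. all: by end_near. Qed.

(** Apply [double_csum] to the array whose row j is the series of [a] delayed by j and multiplied by
    [b j]: its rows sum to [b j * w ^+ j * A], its columns to the convolution. *)
Lemma csum_cauchy_product (a b : nat -> R[i]) (r : R) (w A B : R[i]) :
  0 < r -> cabs w < r ->
  (exists M, forall k, cabs (a k) * r ^+ k <= M) ->
  (exists M, forall k, cabs (b k) * r ^+ k <= M) ->
  csum (fun k => a k * w ^+ k) A -> csum (fun k => b k * w ^+ k) B ->
  csum (fun k => (\sum_(j < k.+1) b j * a (k - j)%N) * w ^+ k) (B * A).
Proof.
move=> r0 wr [Ma aM] [Mb bM] wA wB.
(* At radius r itself the row bounds would not decay. At a smaller radius r1 they are geometric in j
   with ratio r1/r < 1. *)
have [r1 wr1 r1r] : exists2 r1, cabs w < r1 & r1 < r.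
  by exists ((cabs w + r) / 2); rewrite midf_lt.
have r10 : 0 < r1 by exact: le_lt_trans (cabs_ge0 w) wr1.
have Mb0 : 0 <= Mb by have := bM 0%N; rewrite expr0 mulr1; exact/le_trans/cabs_ge0.
have Ma0 : 0 <= Ma by have := aM 0%N; rewrite expr0 mulr1; exact/le_trans/cabs_ge0.
have r1_ge0 := ltW r10; have r_ge0 := ltW r0.
have q0 : 0 <= r1 / r by rewrite divr_ge0.
pose a' j k := if (j <= k)%N then b j * a (k - j)%N else 0.
have [|||||S HS1 HS2] := @double_csum a' (fun j => Mb * (r1 / r) ^+ j * Ma) r1
  (fun j => b j * w ^+ j * A) (fun k => \sum_(j < k.+1) b j * a (k - j)%N) w r10.
- move=> j k; rewrite /a'; case: ifPn => jk; last first.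
    by rewrite cabs0 mul0r !mulr_ge0// exprn_ge0.
  rewrite -{2}(subnKC jk) exprD cabsM mulrACA ler_pM ?mulr_ge0 ?cabs_ge0 ?exprn_ge0//.
    rewrite expr_div_n mulrA ler_pdivlMr ?exprn_gt0// mulrAC ler_wpM2r//.
    by rewrite exprn_ge0.
  rewrite (le_trans _ (aM (k - j)%N))// ler_wpM2l ?cabs_ge0// lerXn2r ?nnegrE// ltW//.
- have := @is_cvg_geometric_series R (Mb * Ma) (r1 / r) _.
  under [X in _ -> cvgn (series X)]eq_fun do rewrite mulrAC.
  by apply; rewrite ger0_norm// ltr_pdivrMr// mul1r.
- exact: wr1.
- move=> j; apply: eq_csum (csum_delay j (csumZ (b j * w ^+ j) wA)) => k.
  rewrite /a'; case: ifPn => jk; last by rewrite mul0r.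
  by rewrite mulrACA -exprD subnKC.
- move=> k; have := @csum_finite (fun j => a' j k) k.+1 _.
  rewrite /series/= big_mkord; set s1 := \sum_(_ < _) _; set s2 := \sum_(_ < _) _.
  have -> : s1 = s2.
    by apply: eq_bigr => j _; rewrite /a' -ltnS ltn_ord.
  by apply=> j kj; rewrite /a' leqNgt kj.
- have -> // : B * A = S.
  apply: csum_unique HS1; rewrite mulrC; apply: eq_csum (csumZ A wB) => k.
  by rewrite mulrC.
Qed.

End ComplexSeries.

(** * The complex exponential: functional equation and power series *)

Section ComplexExp.
Variable R : realType.
Implicit Types (z w : R[i]) (x y : R).

Lemma cabs_cis y : cabs (cos y +i* sin y) = 1.
Proof. by rewrite /cabs normc_def /= cos2Dsin2 sqrtr1. Qed.

Lemma cabs_cexp z : cabs (cexp z) = expR (complex.Re z).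
Proof. by rewrite /cexp cabsM cabs_cis mulr1 cabsC ger0_norm ?expR_ge0. Qed.

Lemma cexpD z w : cexp (z + w) = cexp z * cexp w.
Proof.
case: z w => [a b] [c d]; rewrite /cexp /= expRD cosD sinD.
by apply/eqP; rewrite eq_complex /=; apply/andP; split; apply/eqP; ring.
Qed.

Lemma cexp0 : cexp (0 : R[i]) = 1.
Proof. by rewrite /cexp /= expR0 cos0 sin0 mul1r. Qed.

Lemma cexpM_natl n z : cexp (n%:R * z) = cexp z ^+ n.
Proof.
elim: n => [|n IH]; first by rewrite mul0r cexp0.
by rewrite exprS -nat1r mulrDl mul1r cexpD IH.
Qed.

Lemma cexp_real x : cexp x%:C = (expR x)%:C.
Proof. by rewrite /cexp /= cos0 sin0 mulr1. Qed.

Lemma cexp_two_pi_i : cexp (two_pi_i R) = 1.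
Proof. by rewrite /cexp /= expR0 mul1r mulr_natl cos2pi sin2pi. Qed.

Lemma csum_expR x : csum (fun n => x%:C ^+ n / n`!%:R) (expR x)%:C.
Proof.
have termE n : x%:C ^+ n / n`!%:R = (exp_coeff x n)%:C.
  by rewrite /exp_coeff /= rmorphM rmorphXn fmorphV rmorph_nat.
apply: (@eq_csum _ (fun n => (exp_coeff x n)%:C)) => [n|]; first by rewrite termE.
apply: ccvg_ReIm.
- under eq_fun do rewrite /series/= sum_Re /=.
  exact: is_cvg_series_exp_coeff.
- under eq_fun do rewrite /series/= sum_Im /= big1//.
  exact: cvg_cst.
Qed.

(** The form with parities and halved exponents is the one of [cos_coeff] and [sin_coeff]. *)
Lemma exprn_imaginary y n : (0 +i* y) ^+ n =
  ((~~ odd n)%:R * (-1) ^+ n./2 * y ^+ n) +i* ((odd n)%:R * (-1) ^+ n.-1./2 * y ^+ n).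
Proof.
elim: n => [|n IH]; first by rewrite !expr0 /= !mul1r mul0r mul0r.
rewrite exprS {}IH; apply/eqP; rewrite eq_complex /=.
case: n => [|n]; first by rewrite !expr0 expr1 /=; apply/andP; split; apply/eqP; ring.
rewrite /= negbK [in X in _ && X]exprS; case: (boolP (odd n)) => on /=;
  rewrite ?uphalf_half ?on /= ?add0n ?add1n ?exprS; apply/andP; split; apply/eqP; ring.
Qed.

Lemma csum_cis y : csum (fun n => (0 +i* y) ^+ n / n`!%:R) (cos y +i* sin y).
Proof.
have termE n : (0 +i* y) ^+ n / n`!%:R = cos_coeff y n +i* sin_coeff y n.
  rewrite exprn_imaginary /cos_coeff /sin_coeff /= -exprnP.
  have -> : (n`!%:R : R[i])^-1 = (n`!%:R^-1 : R)%:C by rewrite fmorphV rmorph_nat.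
  by apply/eqP; rewrite eq_complex /=; apply/andP; split; apply/eqP; ring.
apply: (@eq_csum _ (fun n => cos_coeff y n +i* sin_coeff y n)) => [n|].
  by rewrite termE.
apply: ccvg_ReIm.
- under eq_fun do rewrite /series/= sum_Re /=.
  rewrite cos.unlock; exact: is_cvg_series_cos_coeff.
- under eq_fun do rewrite /series/= sum_Im /=.
  rewrite sin.unlock; exact: is_cvg_series_sin_coeff.
Qed.

(** Cauchy product of the series for e^(iy) and e^x, evaluated at 1 with radius 2. The coefficient
    bounds at radius 2 come from the convergence of both series at the doubled arguments. *)
Lemma csum_cexp z : csum (fun n => z ^+ n / n`!%:R) (cexp z).
Proof.
case: z => x y.
have bnd (f : R -> R[i]) (g : R -> R[i]) t :
    (forall t, csum (fun n => f t ^+ n / n`!%:R) (g t)) ->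
    f (2 * t) = 2 * f t ->
    exists M, forall k, cabs (f t ^+ k / k`!%:R) * 2 ^+ k <= M.
  move=> /(_ (2 * t)) + ft; rewrite ft => h.
  have [M _ HM] : exists2 M, 0 <= M &
      forall k, cabs (f t ^+ k / k`!%:R) * cabs (2 : R[i]) ^+ k <= M.
    apply: csum_coef_bound; apply: eq_csum h => n /=.
    by rewrite exprMn; ring.
  by exists M => k; have := HM k; rewrite cabs_nat.
have ex1 (a : nat -> R[i]) l : csum a l -> csum (fun k => a k * 1 ^+ k) l.
  by apply: eq_csum => n; rewrite expr1n mulr1.
have := @csum_cauchy_product R _ _ 2 1 _ _ _ _
  (bnd _ _ y csum_cis _) (bnd _ _ x csum_expR _)
  (ex1 _ _ (csum_cis y)) (ex1 _ _ (csum_expR x)).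
rewrite cabs1 ltr1n ltr0n; move=> /(_ isT isT).
have -> : 2 * (0 +i* y) = (0 +i* (2 * y)) :> R[i].
  by apply/eqP; rewrite eq_complex /=; apply/andP; split; apply/eqP; ring.
rewrite rmorphM rmorph_nat => /(_ erefl erefl).
apply: eq_csum => k; rewrite expr1n mulr1.
have -> : x +i* y = (0 +i* y) + x%:C by simpc.
rewrite exprDn mulr_suml; apply: eq_bigr => j _.
have jk : (j <= k)%N by rewrite -ltnS.
have f0 n : (n`!%:R : R[i]) != 0 by rewrite pnatr_eq0 -lt0n fact_gt0.
rewrite -[X in _ = X / _]mulr_natl -(bin_fact jk) !natrM.
have c0 : ('C(k, j)%:R : R[i]) != 0 by rewrite pnatr_eq0 -lt0n bin_gt0.
by field; rewrite !f0 c0.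
Qed.

End ComplexExp.

(** * Finite differences of x^(-s) *)

Section Monomials.
Variable R : realType.
Implicit Types (s : R[i]) (f g : R -> R[i]) (x : R).

(** Differentiation on the positive half-line is taken componentwise, so that real calculus applies
    to each component. *)
Definition cderiv f f' := forall x, 0 < x ->
  is_derive x (1 : R) (fun y => complex.Re (f y) : R) (complex.Re (f' x)) /\
  is_derive x (1 : R) (fun y => complex.Im (f y) : R) (complex.Im (f' x)).

Lemma cReD (z w : R[i]) : complex.Re (z + w) = complex.Re z + complex.Re w.
Proof. by case: z w => ? ? []. Qed.

Lemma cImD (z w : R[i]) : complex.Im (z + w) = complex.Im z + complex.Im w.
Proof. by case: z w => ? ? []. Qed.

Lemma cReN (z : R[i]) : complex.Re (- z) = - complex.Re z.
Proof. by case: z. Qed.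

Lemma cImN (z : R[i]) : complex.Im (- z) = - complex.Im z.
Proof. by case: z. Qed.

Lemma cReM (z w : R[i]) :
  complex.Re (z * w) = complex.Re z * complex.Re w - complex.Im z * complex.Im w.
Proof. by case: z w => ? ? []. Qed.

Lemma cImM (z w : R[i]) :
  complex.Im (z * w) = complex.Re z * complex.Im w + complex.Im z * complex.Re w.
Proof. by case: z w => ? ? []. Qed.

Lemma eq_cderiv f f' g' : (forall x, 0 < x -> f' x = g' x) ->
  cderiv f f' -> cderiv f g'.
Proof. by move=> e fd x x0; rewrite -(e x x0); exact: fd. Qed.

Lemma cderivM f f' g g' : cderiv f f' -> cderiv g g' ->
  cderiv (fun x => f x * g x) (fun x => f' x * g x + f x * g' x).
Proof.
move=> fd gd x x0; have [fr fi] := fd x x0; have [gr gi] := gd x x0; split.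
- have -> : (fun y => complex.Re (f y * g y)) =
    (fun y => complex.Re (f y)) * (fun y => complex.Re (g y)) -
    (fun y => complex.Im (f y)) * (fun y => complex.Im (g y)).
    by apply/funext => y; rewrite cReM.
  by apply: (is_derive_eq (is_deriveB (is_deriveM fr gr) (is_deriveM fi gi)));
     rewrite cReD !cReM /GRing.scale /=; ring.
- have -> : (fun y => complex.Im (f y * g y)) =
    (fun y => complex.Re (f y)) * (fun y => complex.Im (g y)) +
    (fun y => complex.Im (f y)) * (fun y => complex.Re (g y)).
    by apply/funext => y; rewrite cImM.
  by apply: (is_derive_eq (is_deriveD (is_deriveM fr gi) (is_deriveM fi gr)));
     rewrite cImD !cImM /GRing.scale /=; ring.
Qed.

Lemma cderivB f f' g g' : cderiv f f' -> cderiv g g' ->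
  cderiv (fun x => f x - g x) (fun x => f' x - g' x).
Proof.
move=> fd gd x x0; have [fr fi] := fd x x0; have [gr gi] := gd x x0; split.
- have -> : (fun y => complex.Re (f y - g y)) =
    (fun y => complex.Re (f y)) - (fun y => complex.Re (g y)).
    by apply/funext => y; rewrite cReD cReN.
  by apply: is_derive_eq; rewrite cReD cReN.
- have -> : (fun y => complex.Im (f y - g y)) =
    (fun y => complex.Im (f y)) - (fun y => complex.Im (g y)).
    by apply/funext => y; rewrite cImD cImN.
  by apply: is_derive_eq; rewrite cImD cImN.
Qed.

Lemma cderiv_shift f f' : cderiv f f' ->
  cderiv (fun x => f (x + 1)) (fun x => f' (x + 1)).
Proof.
move=> fd x x0; have [|fr fi] := fd (x + 1); first by rewrite addr_gt0.
have sh : is_derive x (1 : R) (fun y : R => y + 1) 1.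
  have -> : (fun y : R => y + 1) = id + cst 1 by [].
  by apply: is_derive_eq; rewrite addr0.
split.
- have -> : (fun y => complex.Re (f (y + 1))) =
    (fun y => complex.Re (f y)) \o (fun y => y + 1) by [].
  by apply: is_derive_eq; rewrite mulr1.
- have -> : (fun y => complex.Im (f (y + 1))) =
    (fun y => complex.Im (f y)) \o (fun y => y + 1) by [].
  by apply: is_derive_eq; rewrite mulr1.
Qed.

Definition fdiff f x := f (x + 1) - f x.

Lemma cderiv_fdiff f f' : cderiv f f' -> cderiv (fdiff f) (fdiff f').
Proof. by move=> fd; apply: cderivB => //; exact: cderiv_shift. Qed.

Lemma cderiv_iter_fdiff K f f' : cderiv f f' ->
  cderiv (iter K fdiff f) (iter K fdiff f').
Proof. by elim: K => // K IH /IH; exact: cderiv_fdiff. Qed.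

(** The mean value theorem holds only for real-valued functions. It is used once for the real and
    once for the imaginary part, whence the factor 2. *)
Lemma cabs_fdiff_le f f' x M : cderiv f f' -> 0 < x ->
  (forall y, x <= y <= x + 1 -> cabs (f' y) <= M) -> cabs (fdiff f x) <= 2 * M.
Proof.
move=> fd x0 f'M.
have x1 : x <= x + 1 by rewrite lerDl.
have mv (h h' : R -> R) : (forall y : R, 0 < y -> is_derive y (1 : R) h (h' y)) ->
   (forall y : R, `|h' y| <= cabs (f' y)) -> `|h (x + 1) - h x| <= M.
  move=> hd hM; have [||c cx ->] := @MVT_segment R h h' _ _ x1.
  - by move=> y /andP[]; rewrite bnd_simp => xy _; apply: hd; exact: lt_trans xy.
  - apply: derivable_within_continuous => y; rewrite in_itv /= => /andP[xy _].
    have /hd hy : 0 < y by exact: lt_le_trans xy.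
    by apply: ex_derive.
  by rewrite addrAC subrr add0r mulr1 (le_trans (hM _))// f'M//; move: cx; rewrite in_itv.
rewrite (le_trans (cabs_le_ReIm _))// mulr_natl mulr2n lerD//.
- rewrite /fdiff cReD cReN; apply: (mv (fun y => complex.Re (f y)) (fun y => complex.Re (f' y))).
  + by move=> y /fd[].
  + by move=> y; exact: Re_le_cabs.
- rewrite /fdiff cImD cImN; apply: (mv (fun y => complex.Im (f y)) (fun y => complex.Im (f' y))).
  + by move=> y /fd[].
  + by move=> y; exact: Im_le_cabs.
Qed.

(* The k-th Taylor coefficient of s |-> x^(-s): csum_mono is the expansion
   x^(-s - w) = sum_k (mono s k x) w^k. *)
Definition mono s k x : R[i] :=
  cexp (- s * (ln x)%:C) * ((- ln x) ^+ k / k`!%:R)%:C.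

(** Differentiating (- ln x)^k / k! lowers k by one; at k = 0 that term of the derivative is 0. *)
Definition mono_lower s k x : R[i] := if k is k'.+1 then mono s k' x else 0.

Lemma monoS s k x : 0 < x -> mono (s + 1) k x = (x^-1)%:C * mono s k x.
Proof.
move=> x0; rewrite /mono mulrA; congr (_ * _).
rewrite opprD mulrDl mulN1r cexpD mulrC; congr (_ * _).
by rewrite -rmorphN cexp_real expRN lnK.
Qed.

Lemma cderiv_cexp_ln (c : R[i]) :
  cderiv (fun x => cexp (c * (ln x)%:C)) (fun x => c * (x^-1)%:C * cexp (c * (ln x)%:C)).
Proof.
case: c => a b x x0.
have cE y : cexp ((a +i* b) * (ln y)%:C) =
    (expR (a * ln y) * cos (b * ln y)) +i* (expR (a * ln y) * sin (b * ln y)).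
  rewrite /cexp /= !mulr0 subr0 add0r.
  by apply/eqP; rewrite eq_complex /=; apply/andP; split; apply/eqP; ring.
have dl (d : R) : is_derive x (1 : R) (fun y => d * ln y) (d * x^-1).
  have -> : (fun y => d * ln y) = d *: (@ln R) by [].
  exact: (is_derive_eq (is_deriveZ d (is_derive1_ln x0))).
have dexp : is_derive x (1 : R) (fun y => expR (a * ln y)) (a * x^-1 * expR (a * ln x)).
  have -> : (fun y => expR (a * ln y)) = expR \o (fun y => a * ln y) by [].
  by apply: is_derive_eq; rewrite mulrC.
have dcos : is_derive x (1 : R) (fun y => cos (b * ln y)) (- (b * x^-1 * sin (b * ln x))).
  have -> : (fun y => cos (b * ln y)) = cos \o (fun y => b * ln y) by [].
  by apply: is_derive_eq; rewrite mulrC mulrN.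
have dsin : is_derive x (1 : R) (fun y => sin (b * ln y)) (b * x^-1 * cos (b * ln x)).
  have -> : (fun y => sin (b * ln y)) = sin \o (fun y => b * ln y) by [].
  by apply: is_derive_eq; rewrite mulrC.
under eq_fun do rewrite cE; under [in X in _ /\ X]eq_fun do rewrite cE.
rewrite cE /=; split.
- have -> : (fun y => expR (a * ln y) * cos (b * ln y)) =
    (fun y => expR (a * ln y)) * (fun y => cos (b * ln y)) by [].
  by apply: is_derive_eq; rewrite /GRing.scale /=; ring.
- have -> : (fun y => expR (a * ln y) * sin (b * ln y)) =
    (fun y => expR (a * ln y)) * (fun y => sin (b * ln y)) by [].
  by apply: is_derive_eq; rewrite /GRing.scale /=; ring.
Qed.

Lemma cderiv_real (h h' : R -> R) :
  (forall x, 0 < x -> is_derive x (1 : R) h (h' x)) ->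
  cderiv (fun x => (h x)%:C) (fun x => (h' x)%:C).
Proof.
by move=> hd x x0; split=> /=; [exact: hd|exact: is_derive_cst].
Qed.

Lemma cderiv_mono s k :
  cderiv (mono s k) (fun x => - s * mono (s + 1) k x - mono_lower (s + 1) k x).
Proof.
have dp : cderiv (fun x => ((- ln x) ^+ k / k`!%:R)%:C)
  (fun x => (- (x^-1 * (if k is k'.+1 then (- ln x) ^+ k' / k'`!%:R else 0)))%:C).
  apply: cderiv_real => x x0.
  have dl : is_derive x (1 : R) (fun y => - ln y) (- x^-1).
    have -> : (fun y => - ln y) = - (@ln R) by [].
    exact: (is_derive_eq (is_deriveN (is_derive1_ln x0))).
  have -> : (fun y : R => (- ln y) ^+ k / k`!%:R) =
     (k`!%:R^-1 : R) *: ((fun y : R => - ln y) ^+ k).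
    by apply/funext => y; rewrite mulrC /GRing.scale /= exprfctE.
  apply: is_derive_eq; rewrite /GRing.scale /=.
  case: k => [|k]; first by rewrite mulr0n !mul0r !mulr0 oppr0.
  rewrite factS natrM /= -mulr_natl.
  have f0 : (k`!%:R : R) != 0 by rewrite pnatr_eq0 -lt0n fact_gt0.
  have c0 : (k.+1%:R : R) != 0 by rewrite pnatr_eq0.
  move: (k.+1%:R : R) c0 => c c0.
  by field; rewrite c0 f0 (lt0r_neq0 x0).
apply: eq_cderiv (cderivM (cderiv_cexp_ln (- s)) dp) => x x0.
rewrite monoS//.
have -> : mono_lower (s + 1) k x = cexp (- s * (ln x)%:C) *
   (x^-1 * (if k is k'.+1 then (- ln x) ^+ k' / k'`!%:R else 0))%:C.
  case: k {dp} => [|k] /=; first by rewrite mulr0 mulr0.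
  by rewrite monoS// /mono [in RHS]rmorphM mulrCA.
by rewrite rmorphN /mono; ring.
Qed.

Lemma iter_fdiff_lin K (c : R[i]) f g x :
  iter K fdiff (fun x => c * f x - g x) x = c * iter K fdiff f x - iter K fdiff g x.
Proof.
elim: K x => // K IH x; rewrite !iterS /fdiff !IH; ring.
Qed.

Lemma iter_fdiff0 K x : iter K fdiff (fun=> 0) x = 0.
Proof. by elim: K x => // K IH x; rewrite iterS /fdiff !IH subrr. Qed.

(** Each difference is bounded by a derivative, and [cderiv_mono] expresses the derivative of
    [mono s] by monomials of exponent [s + 1], which gains a factor 1/x. The constant is the same
    for all k; this uniformity gives the continuation its power series expansions. *)
Lemma cabs_iter_fdiff_mono K s : exists2 C, 0 <= C & forall k x, 1 <= x ->
  cabs (iter K fdiff (mono s k) x) <= C * expR ((1 - complex.Re s - K%:R) * ln x).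
Proof.
elim: K s => [|K IH] s.
  exists 1 => // k x x1; rewrite mul1r subr0 /= /mono cabsM cabs_cexp cabsC.
  have L0 := ln_ge0 x1; have -> : complex.Re (- s * (ln x)%:C) = - complex.Re s * ln x.
    by rewrite cReM cReN /= mulr0 subr0.
  (* The summand 1 in the exponent pays for the logarithms: (ln x)^k / k! <= exp(ln x), uniformly in
     k. *)
  rewrite [1 - _]addrC mulrDl mul1r expRD ler_wpM2l ?expR_ge0//.
  rewrite normrM normrX normrN ger0_norm// ger0_norm ?invr_ge0 ?ler0n//.
  case: k => [|k]; first by rewrite expr0 invr1 mulr1 -(@expR0 R) ler_expR.
  by apply: (le_trans _ (expR_ge1Dxn k L0)); rewrite lerDr.
have [C C0 HC] := IH (s + 1).
pose t := 1 - complex.Re s - K.+1%:R.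
have tE : 1 - complex.Re (s + 1) - K%:R = t.
  by rewrite /t cReD /= -nat1r; ring.
exists (2 * ((cabs s + 1) * C * expR `|t|)).
  by rewrite !mulr_ge0 ?expR_ge0 ?addr_ge0 ?cabs_ge0.
move=> k x x1; have x0 : 0 < x by exact: lt_le_trans x1.
rewrite iterS -(mulrA 2) -/t; apply: (cabs_fdiff_le (cderiv_iter_fdiff K (cderiv_mono s k))) => //.
move=> y /andP[xy yx].
have y1 := le_trans x1 xy; have y0 : 0 < y by exact: lt_le_trans y1.
rewrite iter_fdiff_lin.
have low : cabs (iter K fdiff (mono_lower (s + 1) k) y) <= C * expR (t * ln y).
  case: k => [|k]; last by rewrite -tE; exact: HC.
  by rewrite iter_fdiff0 cabs0 mulr_ge0// expR_ge0.
rewrite (le_trans (cabsD _ _))// cabsN cabsM cabsN.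
(* The derivative is bounded at points y of [x, x + 1], the claim is at x. There ln y - ln x <= y/x
   - 1 <= 1, so the change costs at most the factor exp |t|. *)
have ety : expR (t * ln y) <= expR `|t| * expR (t * ln x).
  rewrite -expRD ler_expR -lerBlDr -mulrBr (le_trans (ler_norm _))// normrM.
  rewrite ler_piMr// ger0_norm ?subr_ge0 ?ler_ln//.
  have -> : ln y - ln x = ln (1 + (y / x - 1)) by rewrite [1 + _]addrC subrK ln_div.
  rewrite (le_trans (le_ln1Dx _))// ?ltrBrDl ?subrr ?divr_gt0//.
  rewrite lerBlDr ler_pdivrMr// (le_trans yx)// mulrDl mul1r lerD2l//.
have -> : (cabs s + 1) * C * expR `|t| * expR (t * ln x) =
   cabs s * (C * (expR `|t| * expR (t * ln x))) + C * (expR `|t| * expR (t * ln x)).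
  by ring.
rewrite lerD//; last by rewrite (le_trans low)// ler_wpM2l.
rewrite ler_wpM2l ?cabs_ge0// (le_trans (HC k y y1))// tE ler_wpM2l//.
Qed.

End Monomials.

(** * Continuation of Dirichlet series with mean-zero periodic coefficients *)

Section Continuation.
Variable R : realType.
Implicit Types (f u : nat -> R[i]) (s w : R[i]).

Definition sdiff u m : R[i] := u m.+1 - u m.

Variable N : nat.
Hypothesis N_gt0 : (0 < N)%N.

Definition mean_zero f := (forall m, f (m + N)%N = f m) /\ \sum_(0 <= i < N) f i = 0.

(** The discrete primitive of f, with the additive constant chosen so that it again has mean zero
    over a period. This allows the summation by parts to be repeated. *)
Definition antidiff f m : R[i] :=
  series f m - (\sum_(0 <= i < N) series f i) / N%:R.

(** Sign and shift are those of summation by parts: these coefficients go with the differences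
    [sdiff u]. *)
Definition next_coef f m : R[i] := - antidiff f m.+1.

Lemma antidiffS f m : antidiff f m.+1 - antidiff f m = f m.
Proof. by rewrite /antidiff opprB addrA subrK seriesSB. Qed.

Lemma series_periodic f m : mean_zero f -> series f (m + N)%N = series f m.
Proof.
case=> fN f0; elim: m => [|m IH].
  by rewrite add0n /series/= f0 big_geq.
by rewrite addSn seriesSr IH fN -seriesSr.
Qed.

Lemma antidiff_periodic f m : mean_zero f -> antidiff f (m + N)%N = antidiff f m.
Proof. by move=> fmz; rewrite /antidiff series_periodic. Qed.

Lemma antidiff_mean_zero f : mean_zero f -> mean_zero (antidiff f).
Proof.
move=> fmz; split=> [m|]; first exact: antidiff_periodic.
rewrite /antidiff sumrB sumr_const_nat subn0 -[X in _ - X]mulr_natr divfK ?subrr//.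
by rewrite pnatr_eq0 -lt0n.
Qed.

Lemma next_coef_mean_zero f : mean_zero f -> mean_zero (next_coef f).
Proof.
move=> /antidiff_mean_zero[gN g0]; split=> [m|].
  by rewrite /next_coef -addSn gN.
rewrite sumrN -(big_add1 _ _ 0 N.+1 xpredT) /= big_nat_recr//=.
rewrite big_ltn// in g0.
case: N N_gt0 gN g0 => // M _ gN g0.
by rewrite -{2}[M.+1]add0n gN addrC g0 oppr0.
Qed.

Lemma mean_zero_bounded f : mean_zero f ->
  exists2 B : R, 0 <= B & forall m, cabs (f m) <= B.
Proof.
move=> [fN _]; exists (\sum_(0 <= i < N) cabs (f i)).
  by apply: sumr_ge0 => i _; exact: cabs_ge0.
move=> m.
have -> : f m = f (m %% N)%N.
  rewrite {1}(divn_eq m N); elim: (m %/ N)%N => [|q <-]; first by rewrite mul0n.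
  by rewrite mulSn -addnA addnC fN.
rewrite big_mkord (bigD1 (Ordinal (ltn_pmod m N_gt0)))//= lerDl.
by apply: sumr_ge0 => i _; exact: cabs_ge0.
Qed.

Lemma summation_by_parts f u n :
  series (fun m => f m * u m) n =
  antidiff f n * u n - antidiff f 0 * u 0 +
  series (fun m => next_coef f m * sdiff u m) n.
Proof.
elim: n => [|n IH]; first by rewrite /series/= !big_geq// subrr addr0.
rewrite !seriesSr IH -[in f n * u n](antidiffS f n) /next_coef /sdiff; ring.
Qed.

(** The boundary term [antidiff f n * u n] tends to 0, because a periodic sequence is bounded. *)
Lemma abel_summation f u l : mean_zero f -> ccvg u 0 ->
  csum (fun m => next_coef f m * sdiff u m) l ->
  csum (fun m => f m * u m) (- (antidiff f 0 * u 0) + l).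
Proof.
move=> fmz u0 ul.
have [B B0 HB] := mean_zero_bounded (antidiff_mean_zero fmz).
have gu0 : ccvg (fun n => antidiff f n * u n) 0.
  apply: (@ccvg_squeeze _ _ _ (fun n => B * cabs (u n - 0))).
    by move=> n; rewrite !subr0 cabsM ler_wpM2r// cabs_ge0.
  rewrite -(mulr0 B); apply: cvgMl_tmp; exact/ccvg_cabs0.
rewrite /csum (_ : series _ = fun n => antidiff f n * u n +
  (- (antidiff f 0 * u 0) + series (fun m => next_coef f m * sdiff u m) n)); last first.
  by apply/funext => n; rewrite summation_by_parts addrA.
rewrite -[X in ccvg _ X]add0r; apply: ccvgD => //; apply: ccvgD => //; exact: ccvg_cst.
Qed.

(* K-fold Abel summation of the sum of f m * u m; by regsumS the value does not
   depend on K as soon as the K-th differences of u are small enough. *)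
Fixpoint regsum K f u : R[i] :=
  if K is K'.+1 then - (antidiff f 0 * u 0%N) + regsum K' (next_coef f) (sdiff u)
  else limn (series (fun m => f m * u m)).

Lemma regsumS K f u l : mean_zero f -> ccvg (iter K sdiff u) 0 ->
  csum (fun m => iter K.+1 next_coef f m * iter K.+1 sdiff u m) l ->
  regsum K.+1 f u = regsum K f u.
Proof.
elim: K f u => [|K IH] f u fmz u0 ul.
  have h := abel_summation fmz u0 ul.
  by rewrite /= (climE h) (climE ul).
rewrite [LHS]/= [RHS]/=; congr (_ + _).
rewrite iterSr in u0; rewrite (iterSr K.+1 next_coef) (iterSr K.+1 sdiff) in ul.
exact: (IH _ _ (next_coef_mean_zero fmz) u0 ul).
Qed.

Lemma csum_regsum K f u : mean_zero f ->
  (forall i, (i <= K)%N -> ccvg (iter i sdiff u) 0) ->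
  (exists l, csum (fun m => iter K next_coef f m * iter K sdiff u m) l) ->
  csum (fun m => f m * u m) (regsum K f u).
Proof.
elim: K f u => [|K IH] f u fmz u0 [l ul].
  by rewrite /= (climE ul).
rewrite /=; apply: abel_summation => //; first exact: (u0 0%N).
apply: IH; first exact: next_coef_mean_zero.
  by move=> i iK; rewrite -iterSr; exact: (u0 i.+1).
by exists l; rewrite !iterSr in ul.
Qed.

(** Each summation by parts splits off a boundary term that is itself a power series in w. The
    series left after K steps has the summable majorant M, so [double_csum] expands it in powers of
    w. *)
Lemma regsum_pseries K f (a : nat -> nat -> R[i]) (phi : R[i] -> nat -> R[i])
    (M : nat -> R) (r : R) :
  mean_zero f -> 0 < r ->
  (forall w m, cabs w < r -> csum (fun k => a m k * w ^+ k) (phi w m)) ->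
  (forall m k, cabs (iter K sdiff (a^~ k) m) * r ^+ k <= M m) ->
  cvgn (series M) ->
  exists b : nat -> R[i], forall w, cabs w < r ->
    csum (fun k => b k * w ^+ k) (regsum K f (phi w)).
Proof.
move=> + r0; elim: K f a phi => [|K IH] f a phi fmz aphi aM cM.
  have [B B0 HB] := mean_zero_bounded fmz.
  have cBM : cvgn (series (fun m => B * M m)) by exact: is_cvg_series_mull.
  have bnd j k : cabs (f j * a j k) * r ^+ k <= B * M j.
    rewrite cabsM -mulrA ler_pM ?mulr_ge0 ?cabs_ge0 ?exprn_ge0 ?(ltW r0)//.
    exact: aM.
  have hb k : csum (fun j => f j * a j k) (limn (series (fun j => f j * a j k))).
    have [||l hl] := @csum_dominated _ (fun j => f j * a j k) (fun j => B * M j / r ^+ k).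
    - by move=> j; rewrite ler_pdivlMr ?exprn_gt0.
    - have -> : (fun j => B * M j / r ^+ k) = (fun j => (r ^+ k)^-1 * (B * M j)).
        by apply/funext => j; rewrite mulrC.
      exact: is_cvg_series_mull.
    by rewrite (climE hl).
  exists (fun k => limn (series (fun j => f j * a j k))) => w wr.
  have [|S HS1 HS2] := @double_csum _ (fun j k => f j * a j k) (fun j => B * M j) r
    (fun j => f j * phi w j) _ w r0 bnd cBM wr _ hb.
    move=> j; apply: eq_csum (csumZ (f j) (aphi w j wr)) => k.
    by rewrite mulrA.
  by rewrite /= (climE HS1).
have [||||b hb] := IH (next_coef f) (fun m k => sdiff (a^~ k) m)
  (fun w => sdiff (phi w)).
- exact: next_coef_mean_zero.
- move=> w m wr; apply: eq_csum (csumB (aphi w m.+1 wr) (aphi w m wr)) => k.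
  by rewrite /sdiff mulrBl.
- by move=> m k; rewrite -iterSr; exact: aM.
- exact: cM.
exists (fun k => - (antidiff f 0 * a 0%N k) + b k) => w wr /=.
rewrite -mulNr; apply: eq_csum (csumD (csumZ (- antidiff f 0) (aphi w 0%N wr)) (hb w wr)) => k.
by rewrite mulrDl; ring.
Qed.

End Continuation.

(** * The continued Dirichlet series and its analyticity *)

Section DirichletContinuation.
Variable R : realType.
Implicit Types (f u : nat -> R[i]) (s w : R[i]).

Lemma csum_mono s w (x : R) :
  csum (fun k => mono s k x * w ^+ k) (mono (s + w) 0 x).
Proof.
have -> : mono (s + w) 0 x = cexp (- s * (ln x)%:C) * cexp (- w * (ln x)%:C).
  by rewrite /mono expr0 invr1 mulr1 mulr1 opprD mulrDl cexpD.
apply: eq_csum (csumZ _ (csum_cexp _)) => k.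
rewrite /mono rmorphM rmorphXn fmorphV rmorph_nat rmorphN /=.
have -> : - w * (ln x)%:C = - (ln x)%:C * w by ring.
by rewrite exprMn !mulrA mulrAC.
Qed.

Lemma iter_sdiff K (f : R -> R[i]) m :
  iter K (@sdiff R) (fun m => f m.+1%:R) m = iter K (@fdiff R) f m.+1%:R.
Proof. by elim: K m => // K IH m; rewrite !iterS /sdiff /fdiff !IH natr1. Qed.

Lemma cvg_series_expR_ln (t : R) : t <= - 2 ->
  cvgn (series (fun m : nat => expR (t * ln m.+1%:R))).
Proof.
move=> t2.
apply: (@series_le_cvg _ _ (fun m : nat => (m.+1%:R ^+ 2)^-1)).
- by move=> m; exact: expR_ge0.
- by move=> m; rewrite invr_ge0 exprn_ge0.
- move=> m; have -> : (m.+1%:R ^+ 2)^-1 = expR (- 2 * ln m.+1%:R) :> R.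
    by rewrite mulNr expRN expRM_natl lnK// posrE.
  by rewrite ler_expR ler_wpM2r// ln_ge0// ler1n.
- apply: nondecreasing_is_cvgn.
    by apply: nondecreasing_series => m _ _; rewrite invr_ge0 exprn_ge0.
  exists 2 => _ [n _ <-].
  (* Telescoping: 1/(n+1)^2 <= 2/((n+1)(n+2)), so the n-th partial sum is at most 2 - 2/(n+1). *)
  rewrite (@le_trans _ _ (2 - 2 / n.+1%:R))//; last first.
    by rewrite gerBl divr_ge0.
  elim: n => [|n IH]; first by rewrite /series/= big_geq// divr1 subrr.
  rewrite seriesSr (le_trans (lerD IH (lexx _)))// -lerBrDl.
  have -> : 2 - 2 / n.+2%:R - (2 - 2 / n.+1%:R) = 2 / n.+1%:R / n.+2%:R :> R.
    rewrite -(natr1 n.+1); set x : R := n.+1%:R.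
    have x0 : 0 < x by rewrite ltr0n.
    by field; rewrite !lt0r_neq0// addr_gt0.
  rewrite /= -subr_ge0 -(natr1 n.+1).
  have : 1 <= n.+1%:R :> R by rewrite ler1n.
  move: (n.+1%:R : R) => x x1; have x0 : 0 < x by exact: lt_le_trans x1.
  have -> : 2 / x / (x + 1) - x ^- 2 = (x - 1) / (x ^+ 2 * (x + 1)).
    by field; rewrite !lt0r_neq0// addr_gt0.
  by rewrite divr_ge0 ?subr_ge0// mulr_ge0 ?exprn_ge0 ?addr_ge0// ltW.
Qed.

Lemma cvg_expR_ln0 (t : R) : t < 0 ->
  (fun m : nat => expR (t * ln m.+1%:R)) @ \oo --> (0 : R).
Proof.
move=> t0; apply/cvgrPdist_lt => e e0; near=> m.
rewrite sub0r normrN ger0_norm ?expR_ge0// -[ltRHS]lnK// ltr_expR.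
rewrite -ltr_ndivrMl// -[ltLHS]expRK ltr_ln ?posrE ?expR_gt0//.
apply: (@lt_trans _ _ m%:R); last by rewrite ltr_nat.
by near: m; exact: nbhs_infty_gtr.
Unshelve. all: by end_near. Qed.

Definition dirichlet_term s m : R[i] := mono s 0 m.+1%:R.

Lemma dirichlet_termE s m :
  dirichlet_term s m = cexp (- s * (ln (m.+1%:R : R))%:C).
Proof. by rewrite /dirichlet_term /mono expr0 invr1 mulr1 mulr1. Qed.

Lemma cabs_iter_sdiff_mono K s : exists2 C, 0 <= C & forall k m,
  cabs (iter K (@sdiff R) (fun m => mono s k m.+1%:R) m) <=
    C * expR ((1 - complex.Re s - K%:R) * ln m.+1%:R).
Proof.
have [C C0 HC] := cabs_iter_fdiff_mono K s; exists C => // k m.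
by rewrite iter_sdiff HC// ler1n.
Qed.

Lemma ccvg_iter_sdiff0 K s : 1 - complex.Re s - K%:R < 0 ->
  ccvg (iter K (@sdiff R) (dirichlet_term s)) 0.
Proof.
move=> sK; have [C C0 HC] := cabs_iter_sdiff_mono K s.
apply: (ccvg_squeeze (v := fun m : nat => C * expR ((1 - complex.Re s - K%:R) * ln m.+1%:R))).
  by move=> m; rewrite subr0; exact: (HC 0%N).
by rewrite -(mulr0 C); apply: cvgMl_tmp; exact: cvg_expR_ln0.
Qed.

Variable N : nat.
Hypothesis N_gt0 : (0 < N)%N.

Lemma csum_iter_dirichlet_term f K s : mean_zero N f -> 3 - complex.Re s <= K%:R ->
  exists l, csum (fun m => f m * iter K (@sdiff R) (dirichlet_term s) m) l.
Proof.
move=> fmz sK.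
have [B B0 HB] := mean_zero_bounded N_gt0 fmz.
have [C C0 HC] := cabs_iter_sdiff_mono K s.
apply: (@csum_dominated _ _
  (fun m : nat => B * (C * expR ((1 - complex.Re s - K%:R) * ln m.+1%:R)))).
  by move=> m; rewrite cabsM ler_pM ?cabs_ge0//; exact: (HC 0%N).
do 2 apply: is_cvg_series_mull; apply: cvg_series_expR_ln.
by move: sK; lra.
Qed.

(** With K >= 3 - Re s the exponent 1 - Re s - K of the K-th differences is at most -2, which makes
    them summable. *)
Definition regularization_order s := Num.bound `|3 - complex.Re s|.

Lemma regularization_orderP s : 3 - complex.Re s <= (regularization_order s)%:R.
Proof. by rewrite (le_trans (ler_norm _))// ltW// archi_boundP. Qed.

Definition dirichlet_continuation f s : R[i] :=
  regsum N (regularization_order s) f (dirichlet_term s).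

Lemma iter_next_coef_mean_zero K f :
  mean_zero N f -> mean_zero N (iter K (next_coef N) f).
Proof. by move=> fmz; elim: K => //= K IH; exact: next_coef_mean_zero. Qed.

(** The order in [dirichlet_continuation] jumps as s varies. Any sufficient order gives the same
    value, so one K serves a whole disc. *)
Lemma dirichlet_continuationE f s K : mean_zero N f -> 3 - complex.Re s <= K%:R ->
  dirichlet_continuation f s = regsum N K f (dirichlet_term s).
Proof.
move=> fmz sK.
have stable K1 d : 3 - complex.Re s <= K1%:R ->
  regsum N (d + K1) f (dirichlet_term s) = regsum N K1 f (dirichlet_term s).
  move=> sK1; elim: d => // d <-.
  have dK1 : K1%:R <= (d + K1)%:R :> R by rewrite ler_nat leq_addl.
  rewrite addSn; move: (d + K1)%N dK1 => n dK1.
  have [|l Hl] := @csum_iter_dirichlet_term (iter n.+1 (next_coef N) f) n.+1 s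
    (iter_next_coef_mean_zero _ fmz).
    by rewrite -natr1; lra.
  apply: regsumS => //; last exact: Hl.
  by apply: ccvg_iter_sdiff0; lra.
have := regularization_orderP s; rewrite /dirichlet_continuation.
move: (regularization_order s) => K' sK'.
by case: (leqP K K') => [|/ltnW] KK'; rewrite -(subnK KK') stable.
Qed.

Lemma csum_dirichlet_continuation f s : mean_zero N f -> 1 < complex.Re s ->
  csum (fun m => f m * dirichlet_term s m) (dirichlet_continuation f s).
Proof.
move=> fmz s1; apply: csum_regsum => //.
  move=> i _; apply: ccvg_iter_sdiff0.
  by have : 0 <= i%:R :> R by []; lra.
apply: csum_iter_dirichlet_term; first exact: iter_next_coef_mean_zero.
exact: regularization_orderP.
Qed.

Lemma analytic_dirichlet_continuation f s0 : mean_zero N f ->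
  analytic_at (dirichlet_continuation f) s0.
Proof.
(* Two more than the order at [s0], so that K is sufficient at every s with |s - s0| < 1. *)
move=> fmz; pose K := (regularization_order s0).+2.
have sK : 5 - complex.Re s0 <= K%:R.
  by have := regularization_orderP s0; rewrite /K -!natr1; lra.
have [C C0 HC] := cabs_iter_sdiff_mono K s0.
have [|||b hb] := @regsum_pseries R N N_gt0 K f (fun m k => mono s0 k m.+1%:R)
  (fun w => dirichlet_term (s0 + w))
  (fun m : nat => C * expR ((1 - complex.Re s0 - K%:R) * ln m.+1%:R)) 1 fmz ltr01.
- by move=> w m _; exact: csum_mono.
- by move=> m k; rewrite expr1n mulr1; exact: HC.
- by apply: is_cvg_series_mull; apply: cvg_series_expR_ln; lra.
exists b, 1; split => // s; rewrite cabsE ltcR => s1.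
apply/ccvgP; rewrite (@dirichlet_continuationE _ _ K)//.
  by have := hb _ s1; rewrite [s0 + _]addrC subrK.
have := le_lt_trans (Re_le_cabs _) s1; rewrite cReD cReN ltr_norml => /andP[h _].
by lra.
Qed.

Lemma is_dirichlet_L_continuation (psi : int -> R[i]) :
  mean_zero N (fun m => psi m.+1%:Z) ->
  is_dirichlet_L psi (dirichlet_continuation (fun m => psi m.+1%:Z)).
Proof.
move=> fmz; split=> [s s1|s _]; last exact: analytic_dirichlet_continuation.
apply/ccvgP; apply: eq_csum (csum_dirichlet_continuation fmz s1) => m.
by rewrite dirichlet_termE.
Qed.

End DirichletContinuation.

(** * The identity theorem on a segment *)

Section Uniqueness.
Variable R : realType.

(** Strong induction on n: once the lower coefficients vanish, dividing by w^n at a zero w gives |c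
    n| <= D |w|, and w can be taken arbitrarily small. *)
Lemma pseries_accumulating_zeros (c : nat -> R[i]) (rho M : R) :
  0 < rho -> (forall k, cabs (c k) * rho ^+ k <= M) ->
  (forall d, 0 < d -> exists2 w, 0 < cabs w < d & csum (fun k => c k * w ^+ k) 0) ->
  forall n, c n = 0.
Proof.
move=> rho0 cM zeros; elim/ltn_ind => n IH.
have M0 : 0 <= M.
  exact: le_trans (mulr_ge0 (cabs_ge0 _) (exprn_ge0 _ (ltW rho0))) (cM 0%N).
(* The terms beyond the n-th form a geometric tail, and 1/(1 - |w|/rho) <= 2 for |w| < rho/2. *)
pose D := 2 * (M / rho ^+ n.+1).
have D0 : 0 <= D by rewrite mulr_ge0// divr_ge0// exprn_ge0// ltW.
have small (w : R[i]) : 0 < cabs w < rho / 2 -> csum (fun k => c k * w ^+ k) 0 ->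
    cabs (c n) <= D * cabs w.
  move=> /andP[w0 wr] /(csum_tail n).
  rewrite [series _ n]big_nat big1 ?subr0; last first.
    by move=> k /andP[_ kn]; rewrite IH// mul0r.
  move=> /(csumZ (w ^+ n)^-1); rewrite mulr0 => h.
  have wn0 : w ^+ n != 0 by rewrite expf_neq0// -cabs_gt0.
  have {}h : csum (fun k => c (k + n)%N * w ^+ k) 0.
    by apply: eq_csum h => k; rewrite exprD; field.
  have := csum_tail 1 h; rewrite /series/= big_nat1 add0n expr0 mulr1 add0r => {}h.
  rewrite -cabsN.
  have q1 : cabs w / rho <= 2^-1 by rewrite ler_pdivrMr// mulrC ltW.
  have q0 : 0 <= cabs w / rho by rewrite divr_ge0// ltW.
  have gs : series (geometric (M / rho ^+ n.+1 * cabs w) (cabs w / rho)) @ \oo -->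
      (M / rho ^+ n.+1 * cabs w) * (1 - cabs w / rho)^-1.
    by apply: cvg_geometric_series; rewrite ger0_norm//; lra.
  apply: le_trans (cabs_csum_le _ h gs) _ => [k /=|].
    rewrite cabsM cabsX addn1 exprS expr_div_n.
    have := cM (k.+1 + n)%N.
    rewrite -ler_pdivlMr ?exprn_gt0// => ck.
    rewrite (le_trans (ler_wpM2r _ ck)) ?mulr_ge0 ?exprn_ge0 ?(ltW w0)//.
    rewrite addSn -addnS addnC exprD le_eqVlt; apply/orP; left; apply/eqP.
    by field; rewrite !expf_neq0 ?lt0r_neq0.
  have -> : D * cabs w = M / rho ^+ n.+1 * cabs w * 2 by rewrite /D; ring.
  rewrite ler_wpM2l//.
    by rewrite mulr_ge0 ?(ltW w0)// divr_ge0// exprn_ge0// ltW.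
  by rewrite -[leRHS]invrK lef_pV2 ?posrE ?invr_gt0//; lra.
apply/eqP; rewrite -cabs_eq0; apply/eqP/le_anti; rewrite cabs_ge0 andbT.
apply/ler_addgt0Pr => e e0; rewrite add0r.
have [|w /andP[w0 wd] hw] := zeros (Num.min (rho / 2) (e / (D + 1))).
  by rewrite lt_min !divr_gt0// ltr_wpDl.
move: wd; rewrite lt_min => /andP[wr we].
rewrite (le_trans (small w _ hw)) ?w0//.
move: we; rewrite ltr_pdivlMr; last by rewrite ltr_wpDl.
by move=> /ltW; apply: le_trans; rewrite mulrC ler_wpM2l ?(ltW w0)// lerDl.
Qed.

Definition real_analytic_at (h : R -> R[i]) (t0 : R) :=
  exists (c : nat -> R[i]) (e : R), 0 < e /\
    forall t, `|t - t0| < e -> csum (fun k => c k * (t - t0)%:C ^+ k) (h t).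

(** The zeros to the left accumulate at [t0], so every coefficient of the expansion there
    vanishes. *)
Lemma real_analytic_zero_left (h : R -> R[i]) (t0 : R) :
  real_analytic_at h t0 -> (forall t, t < t0 -> h t = 0) ->
  exists2 e : R, 0 < e & forall t, t < t0 + e -> h t = 0.
Proof.
move=> [c [e [e0 hc]]] h0; exists e => // t te.
have e20 : 0 < e / 2 by rewrite divr_gt0.
have e2e : e / 2 < e by rewrite ltr_pdivrMr// ltr_pMr// ltr1n.
have xC (x : R) : `|x| < e -> csum (fun k => c k * x%:C ^+ k) (h (t0 + x)).
  by move=> xe; have := hc (t0 + x); rewrite addrAC subrr add0r => /(_ xe).
have c0 : forall n, c n = 0.
  have [|M M0 cM] := @csum_coef_bound _ c (e / 2)%:C (h (t0 + e / 2)).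
    by apply: xC; rewrite ger0_norm ?ltW.
  apply: (@pseries_accumulating_zeros _ (e / 2) M) => // [k|d d0].
    by have := cM k; rewrite cabsC (ger0_norm (ltW e20)).
  pose x := Num.min (e / 2) (d / 2).
  have x0 : 0 < x by rewrite lt_min e20 divr_gt0.
  exists (- x)%:C.
    by rewrite cabsC normrN ger0_norm ?(ltW x0)// x0 /= gt_min; apply/orP; right; lra.
  rewrite -(h0 (t0 - x)) ?gtrBl//; apply: xC; rewrite normrN ger0_norm ?ltW//.
  by rewrite gt_min e2e.
case: (ltP t t0) => [|t0t]; first exact: h0.
have {}te : `|t - t0| < e by rewrite ger0_norm ?subr_ge0// ltrBlDl.
apply: csum_unique (hc t te) _.
apply: (@eq_csum _ (fun=> 0)) => [k|]; first by rewrite c0 mul0r.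
have -> : csum (fun=> 0 : R[i]) 0 = ccvg (fun=> 0 : R[i]) 0.
  by congr ccvg; apply/funext => n; rewrite /series/= big1.
exact: ccvg_cst.
Qed.

(** Let T be the supremum of the t <= b up to which h vanishes. By [real_analytic_zero_left] at T, h
    vanishes somewhat beyond T, which contradicts the supremum if T < b. *)
Lemma real_analytic_zero (h : R -> R[i]) (b : R) : 0 <= b ->
  (forall t, 0 <= t <= b -> real_analytic_at h t) ->
  (forall t, t <= 0 -> h t = 0) -> h b = 0.
Proof.
move=> b0 han h0.
pose S := [set t : R | t <= b /\ forall u, u <= t -> h u = 0].
have S0 : S 0 by split.
have hS : has_sup S by split; [exists 0|exists b => t []].
pose T := sup S.
have T0 : 0 <= T by apply: ub_le_sup => //; case: hS.
have Tb : T <= b by apply: ge_sup; [exists 0|move=> t []].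
have hT t : t < T -> h t = 0.
  by move=> /(sup_gt (ex_intro _ _ S0))[u [_ hu] /ltW]; exact: hu.
have [|e e0 he] := real_analytic_zero_left (han T _) hT; first by rewrite T0.
have [bT|Tlb] := leP b T; first by apply: he; rewrite (le_lt_trans bT)// ltrDl.
pose T1 := Num.min b (T + e / 2).
have e20 : 0 < e / 2 by rewrite divr_gt0.
have : T1 <= T.
  apply: ub_le_sup; first by case: hS.
  split; first by rewrite ge_min lexx.
  move=> u; rewrite le_min => /andP[_ u1]; apply: he; rewrite (le_lt_trans u1)// ltrD2l.
  by rewrite ltr_pdivrMr// ltr_pMr// ltr1n.
by rewrite leNgt lt_min Tlb ltrDl e20.
Qed.

Lemma analytic_at_line (F : R[i] -> R[i]) (p v : R[i]) (t0 : R) :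
  analytic_at F (p + t0%:C * v) -> real_analytic_at (fun t => F (p + t%:C * v)) t0.
Proof.
move=> [a [e [e0 aF]]]; exists (fun n => a n * v ^+ n), (e / (cabs v + 1)).
have v1 : 0 < cabs v + 1 by rewrite ltr_wpDl ?cabs_ge0.
split=> [|t te]; first by rewrite divr_gt0.
have E : p + t%:C * v - (p + t0%:C * v) = (t - t0)%:C * v.
  by rewrite rmorphB; ring.
have := aF (p + t%:C * v); rewrite E cabsE ltcR cabsM cabsC.
move: te; rewrite ltr_pdivlMr// => te.
have lte : `|t - t0| * cabs v < e.
  by apply: le_lt_trans te; rewrite ler_wpM2l// lerDl.
move=> /(_ lte) /ccvgP; apply: eq_csum => k.
by rewrite exprMn; ring.
Qed.

Lemma real_analytic_atB (h g : R -> R[i]) (t0 : R) :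
  real_analytic_at h t0 -> real_analytic_at g t0 ->
  real_analytic_at (fun t => h t - g t) t0.
Proof.
move=> [c [e [e0 hc]]] [c' [e' [e'0 gc]]].
exists (fun n => c n - c' n), (Num.min e e'); split; first by rewrite lt_min e0.
move=> t; rewrite lt_min => /andP[te te'].
apply: eq_csum (csumB (hc t te) (gc t te')) => k.
by rewrite mulrBl.
Qed.

(* The segment from 2 + i to -2 avoids the excluded point 1; at its start both
   functions are the Dirichlet series. *)
Lemma is_dirichlet_L_unique (psi : int -> R[i]) F G :
  is_dirichlet_L psi F -> is_dirichlet_L psi G -> F (1 - 3%:R) = G (1 - 3%:R).
Proof.
move=> [Fs Fa] [Gs Ga].
pose p : R[i] := 2 +i* 1; pose v : R[i] := (- 4) +i* (- 1).
have pvE (t : R) : p + t%:C * v = (2 - 4 * t) +i* (1 - t).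
  by apply/eqP; rewrite eq_complex /=; apply/andP; split; apply/eqP; ring.
have -> : 1 - 3%:R = p + 1%:C * v.
  rewrite pvE; have -> : 1 - 3%:R = (1 - 3%:R : R)%:C by rewrite rmorphB rmorph_nat.
  by apply/eqP; rewrite eq_complex /=; apply/andP; split; apply/eqP; ring.
apply/eqP; rewrite -subr_eq0; apply/eqP.
apply: (@real_analytic_zero (fun t => F (p + t%:C * v) - G (p + t%:C * v)) 1) => //.
  have ne1 (t : R) : p + t%:C * v != 1.
    by rewrite pvE eq_complex /=; apply/negP => /andP[/eqP h1 /eqP h2]; lra.
  by move=> t _; apply: real_analytic_atB; apply: analytic_at_line; [exact: Fa|exact: Ga].
move=> t t0; have s1 : 1 < complex.Re (p + t%:C * v) by rewrite pvE /=; lra.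
apply/eqP; rewrite subr_eq0; apply/eqP.
by apply: ccvg_unique; apply/ccvgP; [exact: Fs|exact: Gs].
Qed.

Lemma dirichlet_LP (psi : int -> R[i]) F : is_dirichlet_L psi F ->
  is_dirichlet_L psi (dirichlet_L psi).
Proof.
by move=> psiF; apply: (@xgetPex _ (fun=> 0) [set G | is_dirichlet_L psi G]); exists F.
Qed.

Lemma dirichlet_LE (psi : int -> R[i]) F : is_dirichlet_L psi F ->
  dirichlet_L psi (1 - 3%:R) = F (1 - 3%:R).
Proof. by move=> psiF; exact: (is_dirichlet_L_unique (dirichlet_LP psiF) psiF). Qed.

End Uniqueness.

(** * Sorting by the gcd with c *)

Section GcdSplit.

Lemma sum_multiples (V : nmodType) (f : nat -> V) d X : (0 < d)%N ->
  \sum_(1 <= M < X.+1 | (d %| M)%N) f M = \sum_(1 <= m < (X %/ d).+1) f (d * m)%N.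
Proof.
move=> d0; elim: X => [|X IH]; first by rewrite div0n !big_geq.
rewrite big_mkcond big_nat_recr//= -big_mkcond IH divnS//.
case: ifPn => dX; last by rewrite addr0.
rewrite -[(true + _)%N]/((X %/ d).+1) [RHS]big_nat_recr//=; congr (_ + f _).
have := divnS X d0; rewrite dX add1n => h.
by rewrite -h mulnC divnK.
Qed.

Lemma eq_gcdn_coprime d M c : (0 < c)%N -> (d %| c)%N ->
  (d == gcdn M c) = (d %| M)%N && coprime (M %/ d) (c %/ d).
Proof.
move=> c0 dc; have d0 := dvdn_gt0 c0 dc.
case: (boolP (d %| M)%N) => dM /=; last first.
  by apply/negP => /eqP dE; rewrite dE dvdn_gcdl in dM.
by rewrite -{1}(divnK dM) -{1}(divnK dc) -muln_gcdl -{1}[d]mul1n eqn_pmul2r// eq_sym.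
Qed.

(** Each M is counted at the one d equal to gcd(M, c); then M = d m with m prime to c/d. *)
Lemma sum_gcd_split (V : nmodType) (f : nat -> V) c X : (0 < c)%N ->
  \sum_(1 <= M < X.+1) f M =
  \sum_(1 <= d < c.+1 | (d %| c)%N)
    \sum_(1 <= m < (X %/ d).+1 | coprime m (c %/ d)) f (d * m)%N.
Proof.
move=> c0.
transitivity (\sum_(1 <= M < X.+1) \sum_(1 <= d < c.+1 | d == gcdn M c) f M).
  apply: eq_bigr => M _; rewrite big_nat1_eq.
  by rewrite gcdn_gt0 c0 orbT ltnS dvdn_leq// dvdn_gcdr.
rewrite (exchange_big_dep xpredT)//= [RHS]big_mkcond [LHS]big_nat [RHS]big_nat.
apply: eq_bigr => d /andP[d0 _]; case: ifPn => dc; last first.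
  by rewrite big1// => M /eqP dE; rewrite dE dvdn_gcdr in dc.
rewrite [RHS]big_mkcond /=.
have -> : \sum_(1 <= m < (X %/ d).+1) (if coprime m (c %/ d) then f (d * m)%N else 0) =
  \sum_(1 <= m < (X %/ d).+1)
    (fun M => if coprime (M %/ d) (c %/ d) then f M else 0) (d * m)%N.
  by apply: eq_bigr => m _; rewrite mulKn.
rewrite -(sum_multiples (fun M => if coprime (M %/ d) (c %/ d) then f M else 0))//.
by rewrite -big_mkcondr; apply: eq_bigl => M; rewrite eq_gcdn_coprime.
Qed.

(** The first two factors determine the third, and c1 c2 divides c exactly when c1 divides c and c2
    divides c/c1. *)
Lemma sum_triple_product (V : nmodType) (F : nat -> nat -> nat -> V) c : (0 < c)%N ->
  \sum_(1 <= c1 < c.+1) \sum_(1 <= c2 < c.+1)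
    \sum_(1 <= c3 < c.+1 | (c1 * c2 * c3 == c)%N) F c1 c2 c3 =
  \sum_(1 <= c1 < c.+1 | (c1 %| c)%N)
    \sum_(1 <= c2 < (c %/ c1).+1 | (c2 %| c %/ c1)%N) F c1 c2 (c %/ c1 %/ c2)%N.
Proof.
move=> c0; rewrite [RHS]big_mkcond [LHS]big_nat [RHS]big_nat.
apply: eq_bigr => c1 /andP[c10 _].
have inner c2 : (0 < c2)%N ->
  \sum_(1 <= c3 < c.+1 | (c1 * c2 * c3 == c)%N) F c1 c2 c3 =
  if (c1 * c2 %| c)%N then F c1 c2 (c %/ c1 %/ c2)%N else 0.
  move=> c20; have c120 : (0 < c1 * c2)%N by rewrite muln_gt0 c10.
  case: ifPn => dc.
    rewrite (eq_bigl (fun c3 => c3 == c %/ c1 %/ c2)%N); last first.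
      by move=> c3; rewrite -divnMA eqn_div// mulnC.
    rewrite big_nat1_eq -divnMA divn_gt0// ltnS leq_div !(dvdn_leq c0 dc)//=.
  by rewrite big1// => c3 /eqP cE; rewrite -cE dvdn_mulr in dc.
transitivity (\sum_(1 <= c2 < c.+1)
   if (c1 * c2 %| c)%N then F c1 c2 (c %/ c1 %/ c2)%N else 0).
  by rewrite big_nat [RHS]big_nat; apply: eq_bigr => c2 /andP[? _]; exact: inner.
case: ifPn => c1c; last first.
  rewrite big1// => c2 _; case: ifPn => // h.
  by rewrite (dvdn_trans (dvdn_mulr _ (dvdnn c1)) h) in c1c.
rewrite -big_mkcond /= (big_cat_nat _ (n := (c %/ c1).+1))//=; last first.
  by rewrite ltnS leq_div.
rewrite [X in _ + X]big1_seq ?addr0; last first.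
  move=> c2 /andP[dc]; rewrite mem_index_iota => /andP[lt _].
  suff : (c2 <= c %/ c1)%N by rewrite leqNgt lt.
  by rewrite leq_divRL// mulnC dvdn_leq.
by apply: eq_bigl => c2; rewrite dvdn_divRL// mulnC.
Qed.

Lemma cvg_divn_infty d : (0 < d)%N -> (fun X => X %/ d)%N @ \oo --> \oo.
Proof.
move=> d0 A [N _ NA]; exists (N * d)%N => // X /= NX.
by apply: NA; rewrite /= leq_divRL.
Qed.

Variable R : realType.

(** The partial sum up to X is a finite sum, over d, of partial sums up to [X %/ d], and each
    [X %/ d] tends to infinity with X. *)
Lemma csum_gcd_split (f : nat -> R[i]) c (l : nat -> R[i]) : (0 < c)%N ->
  (forall d, (d %| c)%N ->
    csum (fun m => (coprime m.+1 (c %/ d))%:R * f (d * m.+1)%N) (l d)) ->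
  csum (fun M => f M.+1) (\sum_(1 <= d < c.+1 | (d %| c)%N) l d).
Proof.
move=> c0 fl.
have -> : csum (fun M => f M.+1) = ccvg (fun X => \sum_(1 <= d < c.+1 | (d %| c)%N)
    series (fun m => (coprime m.+1 (c %/ d))%:R * f (d * m.+1)%N) (X %/ d)%N).
  congr ccvg; apply/funext => X; rewrite /series/= -(big_add1 _ _ 0 X.+1 xpredT).
  rewrite (sum_gcd_split _ _ c0); apply: eq_bigr => d dc.
  rewrite big_mkcond /= big_add1 /=; apply: eq_bigr => m _.
  by case: ifP => _; rewrite ?mul1r ?mul0r.
elim: (index_iota 1 c.+1) => [|d s IH].
  by rewrite big_nil; under eq_fun do rewrite big_nil; exact: ccvg_cst.
rewrite big_cons; under eq_fun do rewrite big_cons; case: ifP => // dc.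
apply: ccvgD => //; apply: (ccvg_comp (fl d dc)).
by apply: cvg_divn_infty; exact: dvdn_gt0 dc.
Qed.

End GcdSplit.

(** * Sums and products of analytic functions *)

Section AnalyticClosure.
Variable R : realType.
Implicit Types (F G : R[i] -> R[i]) (s : R[i]).

Lemma analytic_atD F G s : analytic_at F s -> analytic_at G s ->
  analytic_at (fun z => F z + G z) s.
Proof.
move=> [a [e [e0 aF]]] [b [e' [e'0 bG]]].
exists (fun n => a n + b n), (Num.min e e'); split; first by rewrite lt_min e0.
move=> z; rewrite cabsE ltcR lt_min => /andP[ze ze']; apply/ccvgP.
have /ccvgP h1 : series (fun n => a n * (z - s) ^+ n) @ \oo --> F z.
  by apply: aF; rewrite cabsE ltcR.
have /ccvgP h2 : series (fun n => b n * (z - s) ^+ n) @ \oo --> G z.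
  by apply: bG; rewrite cabsE ltcR.
apply: eq_csum (csumD h1 h2) => k.
by rewrite mulrDl.
Qed.

Lemma analytic_at0 s : analytic_at (fun _ : R[i] => 0) s.
Proof.
exists (fun=> 0), 1; split => // z _; apply/ccvgP.
have -> : series (fun n => 0 * (z - s) ^+ n) = fun=> 0.
  by apply/funext => n; rewrite /series/= big1// => k _; rewrite mul0r.
exact: ccvg_cst.
Qed.

Lemma analytic_at_sum I (r : seq I) (P : pred I) (F : I -> R[i] -> R[i]) s :
  (forall i, P i -> analytic_at (F i) s) ->
  analytic_at (fun z => \sum_(i <- r | P i) F i z) s.
Proof.
move=> aF; elim: r => [|i r IH].
  by under eq_fun do rewrite big_nil; exact: analytic_at0.
have [Pi|Pi] := boolP (P i); last first.
  by under eq_fun do rewrite big_cons (negbTE Pi).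
by under eq_fun do rewrite big_cons Pi; apply: analytic_atD IH; exact: aF.
Qed.

Lemma analytic_atZ F s c : analytic_at F s -> analytic_at (fun z => c * F z) s.
Proof.
move=> [a [e [e0 aF]]]; exists (fun n => c * a n), e; split; [exact: e0|move=> z ze].
have /ccvgP h := aF z ze; apply/ccvgP; apply: eq_csum (csumZ c h) => k.
by rewrite mulrA.
Qed.

(** Cauchy product with the expansion [csum_mono]. Halving the radius leaves a point of convergence
    at which the coefficients of F are bounded. *)
Lemma analytic_at_mono_mul F s x : analytic_at F s ->
  analytic_at (fun z => mono z 0 x * F z) s.
Proof.
move=> [a [e [e0 aF]]].
pose a' n := \sum_(j < n.+1) mono s j x * a (n - j)%N.
have e20 : 0 < e / 2 by rewrite divr_gt0.
exists a', (e / 2); split=> // z; rewrite cabsE ltcR => ze; apply/ccvgP.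
have aFc w : cabs w < e -> csum (fun n => a n * w ^+ n) (F (s + w)).
  move=> we; apply/ccvgP; have := aF (s + w).
  by rewrite addrAC subrr add0r cabsE ltcR; exact.
have e2c : cabs (e / 2)%:C = e / 2 by rewrite cabsC ger0_norm// ltW.
have e2e : e / 2 < e by rewrite ltr_pdivrMr// ltr_pMr// ltr1n.
rewrite -[z](subrK s) [z - s + s]addrC.
apply: (@csum_cauchy_product _ a (fun j => mono s j x) (e / 2)) => //.
- by rewrite addrAC subrr add0r.
- have [|M _ HM] := @csum_coef_bound _ a (e / 2)%:C (F (s + (e / 2)%:C)).
    by apply: aFc; rewrite e2c.
  by exists M => k; have := HM k; rewrite e2c.
- have [M _ HM] := csum_coef_bound (csum_mono s (e / 2)%:C x).
  by exists M => k; have := HM k; rewrite e2c.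
- rewrite [X in csum (fun k => _ * X ^+ k)]addrAC subrr add0r.
  by apply: aFc; exact: lt_trans e2e.
- rewrite [X in csum (fun k => _ * X ^+ k)]addrAC subrr add0r.
  exact: csum_mono.
Qed.

End AnalyticClosure.

(** * L-values at -2 of an odd character times trivial characters *)

Section LValues.
Variable R : realType.
Implicit Types (psi : int -> R[i]).

(** Reversing the order of summation over a period sends m to -m, so the sum equals its own
    negative. *)
Lemma mean_zero_odd (g : int -> R[i]) N : (0 < N)%N ->
  (forall m, g (m + N%:Z) = g m) -> (forall m, g (- m) = - g m) ->
  mean_zero N (fun m => g m.+1%:Z).
Proof.
move=> N0 gN godd; split=> [m|].
  by rewrite -addSn PoszD gN.
pose S := \sum_(0 <= m < N) g m%:Z.
have shiftE : \sum_(0 <= m < N) g m.+1%:Z = S.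
  transitivity (\sum_(1 <= m < N.+1) g m%:Z); first by rewrite big_add1.
  rewrite big_nat_recr//= /S [RHS]big_ltn//.
  by rewrite -[N%:Z]add0r gN addrC.
have oppE : \sum_(0 <= m < N) g m.+1%:Z = - S.
  rewrite big_nat_rev /= /S -sumrN [LHS]big_nat [RHS]big_nat.
  apply: eq_bigr => m /andP[_ mN]; rewrite add0n subnSK// -godd -[RHS]gN.
  by rewrite -subzn ?(ltnW mN)// addrC.
have /eqP : S = - S by rewrite -{1}shiftE oppE.
rewrite -addr_eq0 -mulr2n -mulr_natr mulf_eq0 pnatr_eq0 orbF shiftE => /eqP.
exact.
Qed.

Lemma coprimezDMr (m e k : int) : coprimez (m + k * e) e = coprimez m e.
Proof. by rewrite /coprimez ![gcdz _ e]gcdzC addrC gcdzMDl. Qed.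

Lemma triv_charN e m : triv_char R e (- m) = triv_char R e m.
Proof. by rewrite /triv_char /coprimez gcdNz. Qed.

Lemma triv_char1 : triv_char R 1 = fun=> 1.
Proof. by apply/funext => m; rewrite /triv_char coprimezE coprimen1. Qed.

Lemma triv_char_nat e m : triv_char R e m%:Z = (coprime m e)%:R.
Proof. by rewrite /triv_char coprimezE. Qed.

Lemma dchar_odd psi N : dirichlet_char N psi -> psi (-1) = -1 ->
  forall m, psi (- m) = - psi m.
Proof. by move=> psic odd m; rewrite -mulN1r (dchar_mul psic) odd mulN1r. Qed.

Lemma is_dirichlet_L_odd psi N e : (0 < N)%N -> (0 < e)%N ->
  dirichlet_char N psi -> psi (-1) = -1 ->
  is_dirichlet_L (fun m => triv_char R e m * psi m)
    (dirichlet_L (fun m => triv_char R e m * psi m)).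
Proof.
move=> N0 e0 psic odd.
have psiM k m : psi (m + (k * N)%:Z) = psi m.
  elim: k => [|k IH]; first by rewrite addr0.
  by rewrite mulSn addnC PoszD addrA (dchar_per psic).
have Ne0 : (0 < N * e)%N by rewrite muln_gt0 N0.
have fmz : mean_zero (N * e) (fun m => (fun m => triv_char R e m * psi m) m.+1%:Z).
  apply: (@mean_zero_odd (fun m => triv_char R e m * psi m)) => // m.
    rewrite {2}mulnC psiM; congr (_ * _).
    by rewrite /triv_char PoszM coprimezDMr.
  by rewrite triv_charN (dchar_odd psic odd) mulrN.
exact: dirichlet_LP (is_dirichlet_L_continuation Ne0 fmz).
Qed.

Lemma monoM (s : R[i]) (x y : R) : 0 < x -> 0 < y ->
  mono s 0 (x * y) = mono s 0 x * mono s 0 y.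
Proof.
move=> x0 y0; rewrite /mono !expr0 invr1 !mulr1 lnM// rmorphD.
by rewrite [_ * (_ + _)]mulrDr cexpD.
Qed.

Lemma mono_sqr (n : nat) : (0 < n)%N -> mono (1 - 3%:R) 0 n%:R = n%:R ^+ 2 :> R[i].
Proof.
move=> n0; rewrite /mono expr0 invr1 mulr1 mulr1.
have -> : - (1 - 3%:R) = 2%:R%:C :> R[i].
  by rewrite rmorph_nat; ring.
by rewrite -rmorphM cexp_real expRM_natl lnK ?posrE ?ltr0n// rmorphXn rmorph_nat.
Qed.

Lemma dirichlet_L_gcd_split psi N c : (0 < N)%N -> (0 < c)%N ->
  dirichlet_char N psi -> psi (-1) = -1 ->
  \sum_(1 <= d < c.+1 | (d %| c)%N) psi d%:Z * d%:R ^+ 2 *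
    dirichlet_L (fun m => triv_char R (c %/ d) m * psi m) (1 - 3%:R) =
  dirichlet_L psi (1 - 3%:R).
Proof.
move=> N0 c0 psic odd.
pose L e := dirichlet_L (fun m => triv_char R e m * psi m).
(* [G] interpolates the left side in s. It satisfies the two conditions that characterize the
   L-function of psi, so its value at -2 is the one required. *)
pose G s := \sum_(1 <= d < c.+1 | (d %| c)%N) psi d%:Z * (mono s 0 d%:R * L (c %/ d)%N s).
have LP d : (d %| c)%N -> is_dirichlet_L (fun m => triv_char R (c %/ d) m * psi m)
    (L (c %/ d)%N).
  move=> dc; apply: is_dirichlet_L_odd psic odd => //.
  by rewrite divn_gt0 ?(dvdn_gt0 c0)// dvdn_leq.
rewrite (@dirichlet_LE _ psi G); last first.
  split=> [s s1|s sn1]; last first.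
    apply: analytic_at_sum => d dc; apply: analytic_atZ; apply: analytic_at_mono_mul.
    by have [_] := LP d dc; exact.
  apply/ccvgP.
  apply: (@eq_csum _ (fun M => (fun M => psi M%:Z * mono s 0 M%:R) M.+1)) => [M|].
    by rewrite -dirichlet_termE.
  apply: (csum_gcd_split (f := fun M => psi M%:Z * mono s 0 M%:R) c0) => d dc.
  have [/(_ s s1) /ccvgP h _] := LP d dc.
  have d0 := dvdn_gt0 c0 dc.
  rewrite mulrA; apply: eq_csum (csumZ (psi d%:Z * mono s 0 d%:R) h) => m.
  rewrite triv_char_nat -dirichlet_termE PoszM (dchar_mul psic) natrM.
  by rewrite monoM ?ltr0n// /dirichlet_term; ring.
apply: eq_bigr => d dc; rewrite /G mono_sqr ?mulrA// (dvdn_gt0 c0 dc)//.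
Qed.

End LValues.

(** * Orthogonality of Dirichlet characters *)

Section Orthogonality.
Variable R : realType.
Local Notation C := R[i].

Variable c' : nat.
Let c := c'.+1.

(* The regular representation of the units modulo c, extended by 0 to all residues,
   so that no type of units is needed. *)
Definition regular_mx (m : nat) : 'M[C]_c :=
  \matrix_(i, j) [&& coprime m c, coprime i c & (j == m * i %% c :> nat)%N]%:R.

Lemma regular_mxM m k : regular_mx m *m regular_mx k = regular_mx (m * k)%N.
Proof.
apply/matrixP => i j; rewrite !mxE.
have mi : (m * i %% c < c)%N by rewrite ltn_pmod.
rewrite (bigD1 (Ordinal mi))//= big1 ?addr0 => [|l li]; last first.
  rewrite !mxE (_ : (l == m * i %% c :> nat)%N = false) ?andbF ?mul0r//.
  by apply: contraNF li => /eqP li; apply/eqP/val_inj.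
rewrite !mxE /= eqxx andbT -natrM mulnb; congr (nat_of_bool _)%:R.
rewrite coprime_modl !coprimeMl modnMmr [(k * (m * i))%N]mulnCA mulnA.
by case: (coprime m c); case: (coprime i c); case: (coprime k c).
Qed.

Lemma regular_mx_mod m : regular_mx (m %% c) = regular_mx m.
Proof.
by apply/matrixP => i j; rewrite !mxE coprime_modl modnMml.
Qed.

Lemma regular_mxX m n : regular_mx m ^+ n.+1 = regular_mx (m ^ n.+1)%N.
Proof.
elim: n => [|n IH]; first by rewrite expr1 expn1.
by rewrite exprS IH -[_ * _]/(_ *m _) regular_mxM -expnS.
Qed.

Lemma regular_mx_noncoprime m : ~~ coprime m c -> regular_mx m = 0.
Proof. by move=> /negbTE mc; apply/matrixP => i j; rewrite !mxE mc. Qed.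

Lemma eqn_modMr a b i : coprime i c ->
  (a * i == b * i %[mod c])%N = (a == b %[mod c])%N.
Proof.
move=> ic; wlog ba : a b / (b <= a)%N.
  by move=> W; case: (leqP b a) => [|/ltnW] h; [|rewrite eq_sym [RHS]eq_sym]; exact: W.
by rewrite !eqn_mod_dvd ?leq_mul2r ?ba ?orbT// -mulnBl Gauss_dvdl// coprime_sym.
Qed.

(** The diagonal entry at a unit i is 1 exactly when m i = i, that is m = 1, modulo c; the entries
    at non-units are 0. *)
Lemma tr_regular_mx m : \tr (regular_mx m) = (totient c * (m == 1 %[mod c]))%:R.
Proof.
have -> : \tr (regular_mx m) =
    \sum_(i < c) (coprime c i * (m == 1 %[mod c]))%:R :> C.
  apply: eq_bigr => i _; rewrite !mxE [coprime c i]coprime_sym; congr _%:R.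
  case: (boolP (coprime i c)) => ic; last by rewrite andbF.
  rewrite mul1n /= -{1}(modn_small (ltn_ord i)) eq_sym -{2}[i : nat]mul1n eqn_modMr//.
  case: (boolP (m == 1 %[mod c])%N) => m1; last by rewrite andbF.
  by rewrite -coprime_modl (eqP m1) coprime_modl coprime1n.
rewrite -natr_sum totient_count_coprime big_mkord; congr _%:R.
by rewrite big_distrl.
Qed.

(** By Euler's theorem X (X^phi(c) - 1) annihilates the matrix, and its roots are simple. The factor
    X takes care of the non-units. *)
Lemma regular_mx_diagonalizable m : diagonalizable (regular_mx m).
Proof.
apply/diagonalizableP.
have [r rE] := closed_field_poly_normal ('X^(totient c) - 1 : {poly C}).
have t0 : (0 < totient c)%N by rewrite totient_gt0.
move: rE; rewrite lead_coefDl ?lead_coefXn ?scale1r; last first.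
  by rewrite size_polyXn size_polyN size_poly1.
move=> rE.
have ur : uniq r.
  by rewrite -separable_prod_XsubC -rE separable_Xn_sub_1// pnatr_eq0 -lt0n.
have r0 : 0 \notin r.
  rewrite -root_prod_XsubC -rE rootE !hornerE expr0n.
  by rewrite gtn_eqF// sub0r oppr_eq0 oner_eq0.
exists (0 :: r); first by rewrite /= r0.
apply: mxminpoly_min; rewrite big_cons -rE subr0 rmorphM rmorphB rmorph1 rmorphXn /=.
rewrite !horner_mx_X mulrBr mulr1 -exprS regular_mxX.
case: (boolP (coprime m c)) => mc.
  rewrite (_ : regular_mx (m ^ (totient c).+1) = regular_mx m) ?subrr//.
  rewrite -regular_mx_mod -[RHS]regular_mx_mod; congr regular_mx.
  by rewrite expnS -modnMmr Euler_exp_totient// modnMmr muln1.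
by rewrite !regular_mx_noncoprime ?subrr// coprime_pexpl.
Qed.

(** The matrices commute and are diagonalizable, so one basis makes them all diagonal. Each diagonal
    position gives a multiplicative function of m, and these functions add up to the trace. *)
Lemma simultaneous_eigenvalues : exists lam : 'I_c -> nat -> C,
  [/\ forall i m k, lam i (m * k)%N = lam i m * lam i k,
      forall i m, lam i (m %% c)%N = lam i m,
      forall i m, ~~ coprime m c -> lam i m = 0 &
      forall m, \sum_i lam i m = (totient c * (m == 1 %[mod c]))%:R].
Proof.
have comm m k : comm_mx (regular_mx m) (regular_mx k).
  by rewrite /comm_mx !regular_mxM mulnC.
have /codiagonalizableP[P Pu /allP Pd] :
    {in [seq regular_mx m | m <- iota 0 c] &, forall A B, comm_mx A B} /\
    {in [seq regular_mx m | m <- iota 0 c], forall A, diagonalizable A}.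
  split; first by move=> _ _ /mapP[m _ ->] /mapP[k _ ->]; exact: comm.
  by move=> _ /mapP[m _ ->]; exact: regular_mx_diagonalizable.
pose D m := P *m regular_mx m *m invmx P.
have Ddiag m : is_diag_mx (D m).
  rewrite /D -conjumx//; apply: (Pd (regular_mx m)).
  by rewrite -regular_mx_mod map_f// mem_iota add0n ltn_pmod.
have DM m k : D (m * k)%N = D m *m D k.
  by rewrite /D -regular_mxM !mulmxA mulmxKV.
exists (fun i m => D m i i); split.
- move=> i m k; rewrite DM mxE (bigD1 i)//= big1 ?addr0// => j ji.
  by have /is_diag_mxP -> := Ddiag m; rewrite ?mul0r// eq_sym.
- by move=> i m; rewrite /D regular_mx_mod.
- by move=> i m mc; rewrite /D regular_mx_noncoprime// mulmx0 mul0mx mxE.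
- move=> m; rewrite -[LHS]/(\tr (D m)) /D mxtrace_mulC mulmxA mulVmx// mul1mx.
  exact: tr_regular_mx.
Qed.

(** * Values and orthogonality of a single character *)

Section Characters.
Variable chi : int -> C.
Hypothesis chic : dirichlet_char c chi.

Lemma dchar_addn (x : int) k : chi (x + (k * c)%N%:Z) = chi x.
Proof.
elim: k => [|k IH]; first by rewrite addr0.
by rewrite mulSn addnC PoszD addrA (dchar_per chic).
Qed.

Lemma dchar_modn m : chi (m %% c)%N%:Z = chi m%:Z.
Proof. by rewrite {2}(divn_eq m c) addnC PoszD dchar_addn. Qed.

Lemma dchar_modz (x : int) : chi `|(x %% c%:Z)%Z|%N%:Z = chi x.
Proof.
rewrite gez0_abs ?modz_ge0//.
have aux (y : int) (k : int) : chi (y + k * c%:Z) = chi y.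
  case: k => k; first by rewrite -PoszM dchar_addn.
  rewrite -[in RHS](addr0 y) -[in RHS](addNr (k.+1%:Z * c%:Z)) addrA -PoszM.
  by rewrite dchar_addn NegzE mulNr PoszM.
by rewrite {2}(divz_eq x c%:Z) addrC aux.
Qed.

Lemma dchar_eq0_nat m : (chi m%:Z == 0) = ~~ coprime m c.
Proof. by rewrite (dchar_eq0 chic) coprimezE. Qed.

(** By Euler's theorem the value at a unit is a root of unity. *)
Lemma dchar_norm m : coprime m c -> chi m%:Z * (chi m%:Z)^* = 1.
Proof.
move=> mc; have t0 : (0 < totient c)%N by rewrite totient_gt0.
have chiX n : chi (m ^ n)%N%:Z = chi m%:Z ^+ n.
  elim: n => [|n IH]; first by rewrite expn0 (dchar_one chic).
  by rewrite expnS PoszM (dchar_mul chic) IH exprS.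
have h : chi m%:Z ^+ totient c = 1.
  rewrite -chiX -dchar_modn Euler_exp_totient// dchar_modn.
  exact: dchar_one chic.
rewrite -sqr_normc; apply/eqP; rewrite sqrf_eq1; apply/orP; left.
by rewrite -(pexpr_eq1 (n := totient c))// -normrX h normr1.
Qed.

Lemma reindex_mulmod (F : nat -> C) k : coprime k c ->
  (forall m, F (m %% c)%N = F m) ->
  \sum_(m < c) F m = \sum_(m < c) F (k * m)%N.
Proof.
move=> kc FM; pose h (m : 'I_c) : 'I_c := Ordinal (ltn_pmod (k * m) (ltn0Sn c')).
have hi : injective h.
  move=> x y /(congr1 val) /= /eqP; rewrite ![(k * _)%N]mulnC eqn_modMr//.
  by rewrite !modn_small// => /eqP/val_inj.
rewrite (reindex_inj hi); apply: eq_bigr => m _ /=; exact: FM.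
Qed.

(** If the two functions differ, they differ at a unit k. Replacing m by k m multiplies the sum by
    [lam k] times the conjugate of [chi k], which is not 1, so the sum is 0. This includes the case
    where lam is identically 0. *)
Lemma schur (lam : nat -> C) :
  (forall m k, lam (m * k)%N = lam m * lam k) -> (forall m, lam (m %% c)%N = lam m) ->
  (forall m, ~~ coprime m c -> lam m = 0) ->
  \sum_(m < c) (chi m%:Z)^* * lam m =
  (totient c * [forall m : 'I_c, lam m == chi m%:Z])%:R.
Proof.
move=> lamM lam_mod lam0; case: (boolP [forall m : 'I_c, _]) => [/forallP lamE|].
  rewrite muln1 totient_count_coprime big_mkord natr_sum; apply: eq_bigr => m _.
  rewrite (eqP (lamE m)) coprime_sym mulrC; case: (boolP (coprime m c)) => mc.
    exact: dchar_norm.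
  by have := dchar_eq0_nat m; rewrite mc => /eqP ->; rewrite mul0r.
rewrite negb_forall => /existsP[k lamk]; rewrite muln0.
have kc : coprime k c.
  apply: contraNT lamk => kc; rewrite lam0// eq_sym.
  by rewrite dchar_eq0_nat.
set S := LHS.
have : S = (chi k%:Z)^* * lam k * S.
  rewrite /S mulr_sumr {1}(reindex_mulmod (F := fun m => (chi m%:Z)^* * lam m) kc).
    by apply: eq_bigr => m _; rewrite PoszM (dchar_mul chic) lamM rmorphM; ring.
  by move=> m; rewrite dchar_modn lam_mod.
move/eqP; rewrite -subr_eq0 -{1}[S]mul1r -mulrBl mulf_eq0 => /orP[|/eqP //].
rewrite subr_eq0 => /eqP h; case/negP: lamk; apply/eqP.
by rewrite -[LHS]mul1r -(dchar_norm kc) -mulrA -h mulr1.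
Qed.

End Characters.

(** The list consists of the [lam i] with [lam i 1 = 1], extended periodically to the integers.
    Since [lam i 1] is idempotent, the other [lam i] vanish identically, and the sum over the
    characters is the trace. *)
Lemma dirichlet_group_enum : exists s : seq (int -> C),
  [/\ uniq s, forall chi, (chi \in s) <-> dirichlet_char c chi &
      forall m : nat, \sum_(chi <- s) chi m%:Z = (totient c * (m == 1 %[mod c]))%:R].
Proof.
have [lam [lamM lam_mod lam0 lam_sum]] := simultaneous_eigenvalues.
have t0 : (totient c)%:R != 0 :> C by rewrite pnatr_eq0 -lt0n totient_gt0.
pose X i (x : int) := lam i `|(x %% c%:Z)%Z|%N.
have Xnat i m : X i m%:Z = lam i m by rewrite /X modz_nat absz_nat lam_mod.
have Xdchar i : lam i 1%N = 1 -> dirichlet_char c (X i).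
  move=> lam1; split.
  - by rewrite Xnat.
  - move=> x y; rewrite /X -lamM -[RHS]lam_mod; congr (lam i _).
    have abs_mod z : `|(z %% c%:Z)%Z|%N%:Z = (z %% c%:Z)%Z by rewrite gez0_abs ?modz_ge0.
    suff -> : (x * y %% c%:Z)%Z =
        ((`|(x %% c%:Z)%Z| * `|(y %% c%:Z)%Z|) %% c)%N%:Z by rewrite absz_nat.
    by rewrite -modz_nat PoszM !abs_mod modzMml modzMmr.
  - by move=> x; rewrite /X modzDr.
  - move=> x; rewrite /X; set m := `|_|%N.
    have -> : coprimez x c%:Z = coprime m c.
      by rewrite /coprimez -gcdz_modl /m -[in LHS](@gez0_abs (x %% c%:Z)%Z) ?modz_ge0.
    case: (boolP (coprime m c)) => mc; last by rewrite lam0 ?eqxx.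
    have : lam i m * lam i (m ^ (totient c).-1)%N = 1.
      rewrite -lamM -expnS prednK ?totient_gt0// -lam_mod Euler_exp_totient//.
      by rewrite lam_mod.
    by apply: contra_eqF => /eqP ->; rewrite mul0r eq_sym oner_eq0.
(* By schur and the trace of the regular representation, the eigenvalue functions
   lam i equal to a given character number exactly one. *)
pose b chi i := [forall m : 'I_c, lam i m == chi m%:Z].
have b_card chi : dirichlet_char c chi -> #|[pred i | b chi i]| = 1%N.
  (* One double sum in two orders: the trace leaves only the residue of 1 and gives phi(c), while
     [schur] gives phi(c) times the number of matching i. *)
  move=> chic; have := erefl (\sum_i \sum_(m < c) (chi m%:Z)^* * lam i m).
  rewrite {1}exchange_big /=.
  under eq_bigr => m _ do rewrite -mulr_sumr lam_sum.
  under [in RHS]eq_bigr => i _ do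
    rewrite (schur chic (lamM i) (lam_mod i) (lam0 i)) natrM.
  rewrite -mulr_sumr (bigD1 (Ordinal (ltn_pmod 1 (ltn0Sn c'))))//= big1 ?addr0; last first.
    move=> m m1; rewrite [X in (_ * X)%N](_ : _ = 0%N) ?muln0 ?mulr0//.
    apply/eqP; rewrite eqb0; apply: contraNN m1 => /eqP m1; apply/eqP/val_inj => /=.
    by rewrite -m1 modn_small.
  rewrite -/c modn_mod eqxx muln1 (dchar_modn chic) (dchar_one chic) rmorph1 mul1r.
  rewrite -{1}[_%:R]mulr1 => /(mulfI t0)/eqP.
  by rewrite -natr_sum -sum1_card (eq_sym 1) pnatr_eq1 -big_mkcond => /eqP.
have bX i : b (X i) i by apply/forallP => m; rewrite Xnat.
have b_uniq chi i j : dirichlet_char c chi -> b chi i -> b chi j -> i = j.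
  move=> chic bi bj; have : (#|[pred i | b chi i]| <= 1)%N by rewrite b_card.
  by move=> /card_le1_eqP/(_ i j bi bj).
exists [seq X i | i <- enum 'I_c & lam i 1%N == 1]; split.
- have us : uniq [seq i <- enum 'I_c | lam i 1%N == 1].
    by apply: filter_uniq; exact: enum_uniq.
  rewrite map_inj_in_uniq// => i j.
  rewrite !mem_filter => /andP[/eqP i1 _] _ Xij.
  apply: (b_uniq (X i)) => //; first exact: Xdchar.
  by rewrite Xij.
- move=> chi; split=> [/mapP[i + ->]|chic].
    by rewrite mem_filter => /andP[/eqP /Xdchar].
  have := b_card _ chic; case: (pickP [pred i | b chi i]) => [i /forallP bi _|none]; last first.
    by rewrite (eq_card0 none).
  have chiE m : lam i m = chi m%:Z.
    rewrite -lam_mod -(dchar_modn chic).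
    exact/eqP/(bi (Ordinal (ltn_pmod m (ltn0Sn c')))).
  apply/mapP; exists i.
    by rewrite mem_filter mem_enum andbT chiE (dchar_one chic).
  by apply/funext => x; rewrite /X chiE (dchar_modz chic).
- move=> m; rewrite big_map big_filter -lam_sum big_enum_cond big_mkcond /=.
  apply: eq_bigr => i _; rewrite Xnat; case: eqP => // /eqP l1.
  have : lam i 1%N * (lam i 1%N - 1) = 0 by rewrite mulrBr mulr1 -lamM muln1 subrr.
  move=> /eqP; rewrite mulf_eq0 subr_eq0 (negbTE l1) orbF => /eqP l0.
  by rewrite -[m]muln1 lamM l0 mulr0.
Qed.

End Orthogonality.

(** * Enumeration of the characters and inversion of Gauss sums *)

Section GaussSums.
Variable R : realType.
Local Notation C := R[i].

(* Meaningful only for 0 < c. *)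
Definition dchar_enum (c : nat) : seq (int -> C) :=
  projT1 (cid (dirichlet_group_enum R c.-1)).

Lemma dchar_enum_uniq c : uniq (dchar_enum c).
Proof. by rewrite /dchar_enum; case: cid => s /= []. Qed.

Lemma mem_dchar_enum c chi : (0 < c)%N -> chi \in dchar_enum c <-> dirichlet_char c chi.
Proof. by rewrite /dchar_enum; case: cid => s /= [_ +  _] c0; rewrite prednK. Qed.

Lemma sum_dchar_enum c m : (0 < c)%N ->
  \sum_(chi <- dchar_enum c) chi m%:Z = (totient c * (m == 1 %[mod c]))%:R.
Proof. by rewrite /dchar_enum; case: cid => s /= [_ _ +] c0; rewrite prednK. Qed.

Lemma fsum_dirichlet_group c (F : (int -> C) -> C) : (0 < c)%N ->
  \sum_(chi \in dirichlet_group R c) F chi = \sum_(chi <- dchar_enum c) F chi.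
Proof.
move=> c0; rewrite [RHS]fsbig_seq ?dchar_enum_uniq//.
suff -> : dirichlet_group R c = [set` dchar_enum c] by [].
by apply/seteqP; split=> chi /=; rewrite mem_dchar_enum.
Qed.

(** For a unit n the conjugate of [chi n] is the value at the inverse n^(phi(c) - 1), which reduces
    the sum to [sum_dchar_enum]. *)
Lemma dchar_second_orthogonality c (x : int) n : (0 < c)%N ->
  \sum_(chi <- dchar_enum c) chi x * (chi n%:Z)^* =
  (totient c * (coprime n c && (n == `|(x %% c%:Z)%Z| %[mod c])))%:R.
Proof.
case: c => // c' _; set c := c'.+1.
have eqchi chi : chi \in dchar_enum c -> dirichlet_char c chi by move=> /mem_dchar_enum; exact.
case: (boolP (coprime n c)) => nc /=; last first.
  rewrite muln0 big_seq big1// => chi /eqchi chic.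
  by have := dchar_eq0_nat chic n; rewrite nc => /eqP ->; rewrite rmorph0 mulr0.
pose n' := (n ^ (totient c).-1)%N.
have nn' : (n' * n = 1 %[mod c])%N.
  by rewrite /n' -expnSr prednK ?totient_gt0// Euler_exp_totient.
set y := `|(x %% c%:Z)%Z|%N.
rewrite (_ : (n == y %[mod c])%N = (y * n' == 1 %[mod c])%N); last first.
  rewrite -(eqn_modMr (y * n')%N 1 nc) -mulnA -modnMmr nn' modnMmr muln1 mul1n.
  by rewrite eq_sym.
rewrite -sum_dchar_enum// big_seq [RHS]big_seq; apply: eq_bigr => chi /eqchi chic.
rewrite PoszM (dchar_mul chic) (dchar_modz chic); congr (_ * _).
have h : chi n'%:Z * chi n%:Z = 1.
  by rewrite -(dchar_mul chic) -PoszM -(dchar_modn chic) nn' (dchar_modn chic) (dchar_one chic).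
by rewrite -[LHS]mul1r -h -mulrA (dchar_norm chic nc) mulr1.
Qed.

Lemma cexp_two_pi_i_int (k : int) : cexp (two_pi_i R * k%:~R) = 1.
Proof.
have h n : cexp (two_pi_i R * n%:R) = 1 by rewrite mulrC cexpM_natl cexp_two_pi_i expr1n.
case: k => n; first exact: h.
rewrite NegzE rmorphN mulrN.
have := cexpD (- (two_pi_i R * n.+1%:~R)) (two_pi_i R * n.+1%:~R).
by rewrite addNr cexp0 [in X in _ = _ * X]h mulr1.
Qed.

(** Fourier inversion on the units: after opening the Gauss sums, orthogonality keeps only the
    residue n = x modulo c, provided that x is a unit. *)
Lemma gauss_sum_inversion c (x : int) : (0 < c)%N ->
  \sum_(chi <- dchar_enum c) chi x * gauss_sum c (conj_char chi) =
  (totient c)%:R * (coprimez x c%:Z)%:R * cexp (two_pi_i R * x%:~R / c%:R).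
Proof.
move=> c0; pose y := `|(x %% c%:Z)%Z|%N.
have yE : y%:Z = (x %% c%:Z)%Z by rewrite /y gez0_abs// modz_ge0// eqz_nat -lt0n.
have yc : (y < c)%N by rewrite -ltz_nat yE ltz_pmod.
transitivity (\sum_(0 <= n < c) (\sum_(chi <- dchar_enum c) chi x * (chi n%:Z)^*) *
    cexp (two_pi_i R * n%:R / c%:R)).
  under [RHS]eq_bigr => n _ do rewrite mulr_suml.
  rewrite [RHS]exchange_big /=; apply: eq_bigr => chi _.
  by rewrite /gauss_sum mulr_sumr; apply: eq_bigr => n _; rewrite mulrA.
under eq_bigr => n _ do rewrite dchar_second_orthogonality//.
rewrite big_mkord (bigD1 (Ordinal yc))//= big1 ?addr0 => [|n ny]; last first.
  rewrite [X in (_ * X)%N](_ : _ = 0%N) ?muln0 ?mul0r//.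
  apply/eqP; rewrite eqb0 negb_and; apply/orP; right; apply: contraNN ny => /eqP.
  by rewrite -/y !modn_small// => ny; apply/eqP/val_inj.
rewrite -/y eqxx andbT natrM; congr (_ * _%:R * _).
  by rewrite /coprimez -gcdz_modl -yE.
have c0' : c%:R != 0 :> C by rewrite pnatr_eq0 -lt0n.
have -> : two_pi_i R * x%:~R / c%:R =
    two_pi_i R * (x %/ c%:Z)%Z%:~R + two_pi_i R * y%:R / c%:R.
  rewrite {1}(divz_eq x c%:Z) -yE rmorphD rmorphM /= -!pmulrn.
  by field.
by rewrite cexpD cexp_two_pi_i_int mul1r.
Qed.

Lemma cabs_dchar_le1 c (chi : int -> C) (m : nat) : (0 < c)%N -> dirichlet_char c chi ->
  cabs (chi m%:Z) <= 1.
Proof.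
case: c => // c' _ chic; case: (boolP (coprime m c'.+1)) => mc; last first.
  by have := dchar_eq0_nat chic m; rewrite mc => /eqP ->; rewrite cabs0.
have := dchar_norm chic mc; rewrite -sqr_normc cabsE -rmorphXn => /complexI/eqP.
by rewrite pexpr_eq1// ?cabs_ge0// => /eqP ->.
Qed.

Lemma dchar1_triv (chi : int -> C) : dirichlet_char 1 chi -> chi = triv_char R 1.
Proof.
move=> chic; apply/funext => m; rewrite triv_char1 -(dchar_modz chic).
by rewrite modz1 (dchar_modn chic 1) (dchar_one chic).
Qed.

Lemma triv_char_dchar1 : dirichlet_char 1 (triv_char R 1).
Proof.
by split=> [|m n|m|m]; rewrite triv_char1 ?mulr1//= coprimezE coprimen1 oner_eq0.
Qed.

(** A character modulo c > 1 vanishes at 0. Hence only c3 = 1 contributes constant terms. *)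
Lemma dchar_neq_triv1 c (chi : int -> C) : (1 < c)%N -> dirichlet_char c chi -> chi != triv_char R 1.
Proof.
move=> c1 chic; apply/negP => /eqP chiE.
have := dchar_eq0 chic 0; rewrite chiE triv_char1 oner_eq0 coprimezE /= /coprime gcd0n.
by rewrite gtn_eqF.
Qed.

Lemma sum_dchar_enum1 (F : (int -> C) -> C) :
  \sum_(chi <- dchar_enum 1) F chi = F (triv_char R 1).
Proof.
have m1 : triv_char R 1 \in dchar_enum 1 by apply/mem_dchar_enum => //; exact: triv_char_dchar1.
rewrite (bigD1_seq _ m1 (dchar_enum_uniq 1)) /= big_seq_cond big1 ?addr0// => chi.
by move=> /andP[/mem_dchar_enum-/(_ isT)/dchar1_triv ->]; rewrite eqxx.
Qed.

Lemma gauss_sum1 : gauss_sum 1 (conj_char (triv_char R 1)) = 1.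
Proof.
by rewrite /gauss_sum big_nat1 /conj_char triv_char1 rmorph1 mulr0 mul0r cexp0 mulr1.
Qed.

(** Half of the decay absorbs the square: exp(x) >= x^2/2 at x = m L/2 gives m^2 exp(-m L) <=
    (8/L^2) exp(-m L/2). *)
Lemma cvg_series_sqr_geometric (L : R) : 0 < L ->
  cvgn (series (fun j : nat => j.+1%:R ^+ 2 * expR (- L) ^+ j.+1)).
Proof.
move=> L0; pose s := expR (- (L / 2)).
have s1 : `|s| < 1 by rewrite ger0_norm ?expR_ge0// expR_lt1 oppr_lt0 divr_gt0.
have := @is_cvg_geometric_series R (8 / L ^+ 2 * s) s s1.
have L2 : 0 <= 8 / L ^+ 2 by rewrite divr_ge0// sqr_ge0.
apply: series_le_cvg => j.
- by rewrite mulr_ge0 ?sqr_ge0// exprn_ge0// expR_ge0.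
- have s0 : 0 <= s by exact: expR_ge0.
  by apply: mulr_ge0; [exact: mulr_ge0|exact: exprn_ge0].
rewrite /= -(mulrA (8 / L ^+ 2)) -exprS; set m : R := j.+1%:R.
have m0 : 0 <= m by [].
rewrite -!expRM_natl -/m.
have -> : m * - L = m * - (L / 2) + - (m * (L / 2)) by field.
rewrite expRD mulrCA mulrC ler_wpM2r ?expR_ge0// expRN ler_pdivrMr ?expR_gt0//.
rewrite -ler_pdivrMl ?divr_gt0 ?exprn_gt0//.
have h := @expR_ge1Dxn R (m * (L / 2)) 1 _.
rewrite (le_trans _ (h _)) ?mulr_ge0 ?divr_ge0 ?(ltW L0)//.
rewrite (_ : (8 / L ^+ 2)^-1 * m ^+ 2 = (m * (L / 2)) ^+ 2 / 2`!%:R) ?lerDr//.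
rewrite (_ : 2`!%:R = 2)//; field; exact: lt0r_neq0.
Qed.

End GaussSums.

(** * The translation formula *)

Section Translation.
Variable R : realType.
Local Notation C := R[i].

Lemma cabs_nome (tau : C) :
  cabs (cexp (two_pi_i R * tau)) = expR (- (2 * pi * complex.Im tau)).
Proof. by rewrite cabs_cexp cReM /= mul0r sub0r. Qed.

Lemma one_sub_neq0 (x : C) : cabs x < 1 -> 1 - x != 0.
Proof.
by move=> x1; apply/eqP => /subr0_eq h; rewrite -h cabs1 ltxx in x1.
Qed.

(** With rho = |q|, all exponents of q are at least m, so each of the M inner summands is at most
    rho^m / (1 - rho). *)
Lemma eisenstein_series_cvg (chi psi : int -> C) (q : C) (L : R) M n :
  0 < L -> cabs q = expR (- L) -> (0 < M)%N -> (0 < n)%N ->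
  (forall m : nat, cabs (chi m%:Z) <= 1) -> (forall m : nat, cabs (psi m%:Z) <= 1) ->
  exists l, csum (fun j : nat => let m := j.+1 in psi m%:Z * m%:R ^+ 2 *
    \sum_(1 <= nu < M.+1) chi nu%:Z * q ^+ (nu * m * n) / (1 - q ^+ (M * m * n))) l.
Proof.
move=> L0 qL M0 n0 chi1 psi1; set rho := cabs q.
have rho0 : 0 <= rho by exact: cabs_ge0.
have rho1 : rho < 1 by rewrite /rho qL expR_lt1 oppr_lt0.
apply: (@csum_dominated _ _ (fun j : nat =>
    M%:R * (1 - rho)^-1 * (j.+1%:R ^+ 2 * expR (- L) ^+ j.+1))); last first.
  by apply: is_cvg_series_mull; exact: cvg_series_sqr_geometric.
move=> j /=; rewrite -qL -/rho; set m := j.+1.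
have rhoX k : (m <= k)%N -> cabs (q ^+ k) <= rho ^+ m.
  by move=> mk; rewrite cabsX ler_wiXn2l// ltW.
have -> : M%:R * (1 - rho)^-1 * (m%:R ^+ 2 * rho ^+ m) =
    1 * m%:R ^+ 2 * (\sum_(1 <= nu < M.+1) rho ^+ m / (1 - rho)).
  by rewrite sumr_const_nat subSS subn0 -[in RHS]mulr_natl; ring.
rewrite cabsM ler_pM ?cabs_ge0//.
  by rewrite cabsM cabsX cabs_nat ler_wpM2r ?exprn_ge0.
rewrite (le_trans (cabs_sum _ _ _))// !big_nat; apply: ler_sum => nu /andP[nu0 _].
rewrite cabsM cabsV ler_pM ?invr_ge0 ?cabs_ge0//.
  rewrite cabsM -[leRHS]mul1r ler_pM ?cabs_ge0// rhoX//.
  by rewrite mulnAC leq_pmull// muln_gt0 nu0.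
rewrite lef_pV2 ?posrE ?subr_gt0//; last first.
  rewrite cabs_gt0 one_sub_neq0// (le_lt_trans (rhoX _ _))//.
    by rewrite mulnAC leq_pmull// muln_gt0 M0.
  by rewrite exprn_ilt1// ltW.
have h : 1 - rho <= 1 - cabs (q ^+ (M * m * n)).
  rewrite lerD2l lerN2 (le_trans (rhoX _ _))//.
    by rewrite mulnAC leq_pmull// muln_gt0 M0.
  by rewrite -[leRHS]expr1 ler_wiXn2l// ltW.
rewrite (le_trans h)// lerBlDr -[leLHS]cabs1 -[in leLHS](subrK (q ^+ (M * m * n)) 1).
exact: cabsD.
Qed.

Lemma geometric_sum_period (y : C) e : (0 < e)%N -> cabs y < 1 ->
  y / (1 - y) = \sum_(1 <= V < e.+1) y ^+ V / (1 - y ^+ e).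
Proof.
move=> e0 y1.
have d1 := one_sub_neq0 y1.
have d2 : 1 - y ^+ e != 0.
  by rewrite one_sub_neq0// cabsX exprn_ilt1// ?cabs_ge0// -lt0n.
rewrite big_add1 /= -mulr_suml.
under eq_bigr => i _ do rewrite exprS.
rewrite -mulr_sumr big_mkord.
have -> : 1 - y ^+ e = (1 - y) * \sum_(i < e) y ^+ i.
  by rewrite -opprB subrX1 -mulNr opprB.
have s0 : \sum_(i < e) y ^+ i != 0.
  by apply: contraNneq d2 => s0; rewrite -opprB subrX1 s0 mulr0 oppr0.
by field; rewrite d1 s0.
Qed.

(** The theorem for the single term M = c1 m, used with [x = q ^+ (c1 * m)] and y its translate. The
    ratio y/x is an e-th root of unity, so it disappears from the denominator and survives only in
    the numerators. *)
Lemma local_translation (a : int) (x y : C) e (m : nat) : (0 < e)%N -> cabs x < 1 ->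
  coprime m e -> coprimez a e%:Z ->
  y = x * cexp (two_pi_i R * (a * m%:Z)%:~R / e%:R) ->
  y / (1 - y) =
  \sum_(1 <= c2 < e.+1 | (c2 %| e)%N) \sum_(chi <- dchar_enum R (e %/ c2))
    chi a * gauss_sum (e %/ c2) (conj_char chi) / (totient (e %/ c2))%:R *
    (chi m%:Z *
     \sum_(1 <= nu < (e %/ c2).+1) chi nu%:Z * x ^+ (nu * c2) / (1 - x ^+ e)).
Proof.
move=> e0 x1 me ae; set w := cexp _ => yE.
have e0' : e%:R != 0 :> C by rewrite pnatr_eq0 -lt0n.
have we : w ^+ e = 1.
  rewrite -[RHS](cexp_two_pi_i_int R (a * m%:Z)) -cexpM_natl; congr cexp.
  by move: (_%:~R : C) => z; field.
have wc : cabs w = 1.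
  have := congr1 (@cabs R) we; rewrite cabsX cabs1 => /eqP.
  by rewrite pexpr_eq1 ?cabs_ge0// => /eqP.
have ye : y ^+ e = x ^+ e by rewrite yE exprMn we mulr1.
rewrite (geometric_sum_period e0); last by rewrite yE cabsM wc mulr1.
rewrite ye (sum_gcd_split _ _ e0); apply: eq_bigr => c2 c2e.
set c3 := (e %/ c2)%N.
have c30 : (0 < c3)%N by rewrite divn_gt0 ?(dvdn_gt0 e0 c2e)// dvdn_leq.
have c3e : (c3 %| e)%N by apply: dvdn_div.
have t0 : (totient c3)%:R != 0 :> C by rewrite pnatr_eq0 -lt0n totient_gt0.
have eqchi chi : chi \in dchar_enum R c3 -> dirichlet_char c3 chi.
  by move=> /(mem_dchar_enum _ c30).
transitivity (\sum_(1 <= nu < c3.+1) (\sum_(chi <- dchar_enum R c3)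
   chi (a * m%:Z * nu%:Z) * gauss_sum c3 (conj_char chi)) / (totient c3)%:R *
   (x ^+ (nu * c2) / (1 - x ^+ e))).
  rewrite big_mkcond; apply: eq_bigr => nu _.
  rewrite gauss_sum_inversion//.
  have -> : coprimez (a * m%:Z * nu%:Z) c3%:Z = coprime nu c3.
    rewrite !coprimezMl [coprimez nu%:Z _]coprimezE /=.
    rewrite (_ : coprimez a c3%:Z); last first.
      by apply: coprimez_dvdr ae.
    rewrite (_ : coprimez m%:Z c3%:Z)// coprimezE.
    exact: coprime_dvdr me.
  case: ifP => _; last by rewrite mulr0 mul0r mul0r mul0r.
  rewrite mulr1 [_ * cexp _]mulrC mulfK// yE exprMn mulrA; congr (_ / _).
  rewrite mulrC mulnC; congr (_ * _).
  rewrite -cexpM_natl; congr cexp.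
  have c20' : c2%:R != 0 :> C by rewrite pnatr_eq0 -lt0n (dvdn_gt0 e0 c2e).
  have c30' : c3%:R != 0 :> C by rewrite pnatr_eq0 -lt0n.
  rewrite -[e](divnK c2e) -/c3 !natrM [in RHS]rmorphM /= -pmulrn.
  by field; rewrite c20' c30'.
under eq_bigr => nu _ do rewrite !mulr_suml.
rewrite exchange_big /= big_seq [RHS]big_seq; apply: eq_bigr => chi /eqchi chic.
move: (gauss_sum _ _) => g; rewrite !mulr_sumr; apply: eq_bigr => nu _.
by rewrite !(dchar_mul chic); ring.
Qed.

End Translation.

Lemma csum_sum_seq (R : realType) (I : eqType) (r : seq I) (P : pred I)
    (U : I -> nat -> R[i]) (L : I -> R[i]) :
  (forall i, i \in r -> P i -> csum (U i) (L i)) ->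
  csum (fun n => \sum_(i <- r | P i) U i n) (\sum_(i <- r | P i) L i).
Proof.
move=> UL; rewrite big_seq_cond.
apply: (@eq_csum _ (fun n => \sum_(i <- r | (i \in r) && P i) U i n)) => [n|].
  by rewrite [RHS]big_seq_cond.
by apply: csum_sum => i /andP[]; exact: UL.
Qed.

Theorem proposition5p13 (R : realType) (N : nat) (psi : int -> R[i])
    (N_gt0 : (0 < N)%N) (psi_char : dirichlet_char N psi)
    (psi_odd : psi (-1) = -1)
    (r : rat) (a : int) (c : nat) (r_def : r = a%:~R / c%:R)
    (c_gt0 : (0 < c)%N) (coprime_ac : coprimez a c%:Z)
    (tau : R[i]) (tau_upper : 0 < complex.Im tau) :
  eisenstein_shift psi r tau =
  \sum_(1 <= c1 < c.+1) \sum_(1 <= c2 < c.+1)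
    \sum_(1 <= c3 < c.+1 | (c1 * c2 * c3 == c)%N)
      \sum_(chi \in dirichlet_group R c3)
        chi a * gauss_sum c3 (conj_char chi) * psi c1%:Z * c1%:R ^+ 2
          / (totient c3)%:R *
        eisenstein 3 c3 chi
          (fun m => triv_char R (c2 * c3) m * chi m * psi m) (c1 * c2) tau.
Proof.
pose q := cexp (two_pi_i R * tau).
pose L := 2 * pi * complex.Im tau.
have L0 : 0 < L by rewrite !mulr_gt0// pi_gt0.
have qL : cabs q = expR (- L) by exact: cabs_nome.
pose coef c1 c3 (chi : int -> R[i]) := chi a * gauss_sum c3 (conj_char chi) *
  psi c1%:Z * c1%:R ^+ 2 / (totient c3)%:R.
pose psi' c2 c3 (chi : int -> R[i]) m := triv_char R (c2 * c3) m * chi m * psi m.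
pose U c1 c2 c3 chi (j : nat) := let m := j.+1 in
  psi' c2 c3 chi m%:Z * m%:R ^+ 2 *
  \sum_(1 <= nu < c3.+1) chi nu%:Z * q ^+ (nu * m * (c1 * c2)) /
    (1 - q ^+ (c3 * m * (c1 * c2))).
pose S c1 c2 c3 chi := limn (series (U c1 c2 c3 chi)).
pose T c2 c3 chi := 2^-1 * (chi == triv_char R 1)%:R *
  dirichlet_L (psi' c2 c3 chi) (1 - 3%:R).
(* On the right, c3 becomes c/c1/c2, and each Eisenstein series is its constant term [T] plus its
   q-series [S]. *)
transitivity (\sum_(1 <= c1 < c.+1 | (c1 %| c)%N)
    \sum_(1 <= c2 < (c %/ c1).+1 | (c2 %| c %/ c1)%N)
    \sum_(chi <- dchar_enum R (c %/ c1 %/ c2))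
      coef c1 (c %/ c1 %/ c2)%N chi *
        (T c2 (c %/ c1 %/ c2)%N chi + S c1 c2 (c %/ c1 %/ c2)%N chi)); last first.
  rewrite -(sum_triple_product (fun c1 c2 c3 => \sum_(chi <- dchar_enum R c3)
    coef c1 c3 chi * (T c2 c3 chi + S c1 c2 c3 chi)))//.
  apply: eq_bigr => c1 _; apply: eq_bigr => c2 _; apply: eq_bigr => c3 /eqP c3E.
  have c30 : (0 < c3)%N by move: c_gt0; rewrite -c3E muln_gt0 => /andP[].
  by rewrite fsum_dirichlet_group.
have quot0 d n : (0 < n)%N -> (d %| n)%N -> (0 < n %/ d)%N.
  by move=> n0 dn; rewrite divn_gt0 ?(dvdn_gt0 n0 dn)// dvdn_leq.
have psi1 m : cabs (psi m%:Z) <= 1 by exact: (cabs_dchar_le1 _ N_gt0 psi_char).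
have SP c1 c2 c3 chi : (0 < c1 * c2)%N -> (0 < c3)%N -> chi \in dchar_enum R c3 ->
    csum (U c1 c2 c3 chi) (S c1 c2 c3 chi).
  move=> c12 c30 /(mem_dchar_enum _ c30) chic.
  have chi1 m : cabs (chi m%:Z) <= 1 by exact: (cabs_dchar_le1 _ c30 chic).
  have [|l hl] := @eisenstein_series_cvg R chi (psi' c2 c3 chi) q L c3 (c1 * c2)%N
    L0 qL c30 c12 chi1.
    move=> m; rewrite /psi' triv_char_nat !cabsM -[leRHS]mul1r.
    rewrite ler_pM ?mulr_ge0 ?cabs_ge0//.
    rewrite cabs_nat -[leRHS]mul1r ler_pM ?cabs_ge0//.
    by case: coprime.
  by rewrite /S (climE hl).
under eq_bigr => c1 _ do under eq_bigr => c2 _ do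
  (under eq_bigr => chi _ do rewrite mulrDr; rewrite big_split /=).
under eq_bigr => c1 _ do rewrite big_split /=.
rewrite big_split /= /eisenstein_shift {1}/eisenstein eqxx mulr1; congr (_ + _).
  (* Constant terms: only c3 = 1 survives, that is the last index c2 = e, with Gauss sum 1. What
     remains is the sum in [dirichlet_L_gcd_split]. *)
  rewrite -(dirichlet_L_gcd_split N_gt0 c_gt0 psi_char psi_odd) mulr_sumr.
  apply: eq_bigr => c1 c1c; set e := (c %/ c1)%N.
  have e0 : (0 < e)%N by exact: quot0.
  rewrite big_mkcond big_nat_recr//= dvdnn divnn e0 sum_dchar_enum1 big_nat big1 ?add0r.
    rewrite -[nat_of_bool true]/1%N /coef /T /psi' gauss_sum1 eqxx muln1 triv_char1.
    rewrite (_ : totient 1 = 1%N)//.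
    have -> : (fun m => triv_char R e m * 1 * psi m) = fun m => triv_char R e m * psi m.
      by apply/funext => m; rewrite mulr1.
    by rewrite divr1 !mul1r -[true%:R]/(1 : R[i]); ring.
  move=> c2 /andP[c20 c2e]; case: ifP => // c2de.
  have c31 : (1 < e %/ c2)%N by rewrite ltn_divRL// mul1n.
  rewrite big_seq big1// => chi /(mem_dchar_enum _ (ltnW c31)) chic.
  by rewrite /T (negbTE (dchar_neq_triv1 c31 chic)) mulr0 mul0r mulr0.
(* For the q-series it suffices that the series on the left converges to the right side; it is a
   Lambert series in the translated nome [q'], sorted by gcd(M, c). *)
apply: climE; set q' := cexp _.
pose f M := psi M%:Z * M%:R ^+ 2 * (q' ^+ M / (1 - q' ^+ M)).
apply: (@eq_csum _ (fun j => f j.+1)) => [j|].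
  by rewrite big_nat1 triv_char1 !muln1 !mul1n mul1r.
apply: csum_gcd_split => // c1 c1c; set e := (c %/ c1)%N.
have e0 : (0 < e)%N by exact: quot0.
have c10 := dvdn_gt0 c_gt0 c1c.
have /csum_sum : forall c2, (c2 %| e)%N ->
    csum (fun j => \sum_(chi <- dchar_enum R (e %/ c2)) coef c1 (e %/ c2)%N chi *
      U c1 c2 (e %/ c2)%N chi j)
    (\sum_(chi <- dchar_enum R (e %/ c2)) coef c1 (e %/ c2)%N chi *
      S c1 c2 (e %/ c2)%N chi).
  move=> c2 c2e; apply: csum_sum_seq => chi chis _; apply: csumZ; apply: SP => //.
    by rewrite muln_gt0 c10 (dvdn_gt0 e0).
  exact: quot0.
move=> /(_ (index_iota 1 e.+1)); apply: eq_csum => j; set n := j.+1.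
(* If n is not prime to e, both sides vanish: on the right the trivial character has modulus c2 c3 =
   e. *)
case: (boolP (coprime n e)) => ne; last first.
  rewrite mul0r big1// => c2 c2e; rewrite big1// => chi _.
  rewrite /U /psi' -/n mulnC divnK// triv_char_nat (negbTE ne).
  by rewrite !mul0r mulr0.
have ae : coprimez a e%:Z by apply: coprimez_dvdr coprime_ac; exact: dvdn_div.
pose x := q ^+ (c1 * n).
have x1 : cabs x < 1.
  by rewrite cabsX qL exprn_ilt1 ?expR_ge0 ?expR_lt1 ?oppr_lt0// muln_eq0 negb_or -!lt0n c10.
have yE : q' ^+ (c1 * n) = x * cexp (two_pi_i R * (a * n%:Z)%:~R / e%:R).
  rewrite /q' mulrDr cexpD exprMn; congr (_ * _); rewrite -cexpM_natl; congr cexp.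
  have e0' : e%:R != 0 :> R[i] by rewrite pnatr_eq0 -lt0n.
  have c10' : c1%:R != 0 :> R[i] by rewrite pnatr_eq0 -lt0n.
  rewrite r_def fmorph_div rmorph_int rmorph_nat -(divnK c1c) -/e !natrM.
  rewrite [in RHS]rmorphM /= -pmulrn.
  by move: (a%:~R : R[i]) => A; field; rewrite e0' c10'.
rewrite mul1r /f (local_translation e0 x1 ne ae yE) mulr_sumr; apply: eq_bigr => c2 c2e.
rewrite mulr_sumr; apply: eq_bigr => chi _.
rewrite /U -/n /psi' mulnC divnK// triv_char_nat ne.
have -> : \sum_(1 <= nu < (e %/ c2).+1) chi nu%:Z * q ^+ (nu * n * (c1 * c2)) /
    (1 - q ^+ (e %/ c2 * n * (c1 * c2))) =
  \sum_(1 <= nu < (e %/ c2).+1) chi nu%:Z * x ^+ (nu * c2) / (1 - x ^+ e).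
  apply: eq_bigr => nu _; rewrite /x -!exprM.
  rewrite (_ : (e %/ c2 * n * (c1 * c2) = c1 * n * e)%N).
    by rewrite (_ : (nu * n * (c1 * c2) = c1 * n * (nu * c2))%N)//; ring.
  by rewrite -[in RHS](divnK c2e); ring.
rewrite PoszM (dchar_mul psi_char) natrM /coef.
move: (\sum_(_ <= _ < _) _) (gauss_sum _ _) (n%:R : R[i]) => s g z.
by rewrite -[true%:R]/(1 : R[i]); ring.
Qed.
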